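(* For integers $n\geq m\geq 1$ let $h(n,m)=\operatorname{hdepth}(S_{n,m}/I_{n,m})$, where $S_{n,m}=K[x_1,\ldots,x_n,y_1,\ldots,y_m]$ and $I_{n,m}=(x_iy_j : 1\leq i\leq n,\ 1\leq j\leq m)$. Let $m:\mathbb N \to \mathbb N$ be a function such that $m(n)\leq n$ for all $n\geq 1$. Then $$\lim_{n\to\infty} \frac{1}{n}h(n,m(n))=\frac{1}{2}.$$
   Context: $\mathbb N=\{1,2,3,\ldots\}$ is the set of positive integers. $K$ is a field. Polynomial rings over $K$ carry the standard grading (each variable has degree 1). For a finitely generated graded module $M$ over a polynomial ring $S$ over $K$, the Hilbert depth $\operatorname{hdepth}(M)$ is the maximal depth of a finitely generated graded $S$-module $N$ having the same Hilbert series as $M$. *)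

(* Defs.v *)
From HB Require Import structures.
From mathcomp Require Import all_boot all_order all_algebra.
From mathcomp Require Import boolp classical_sets.
From mathcomp.multinomials Require Import mpoly.

Set Implicit Arguments.
Unset Strict Implicit.
Unset Printing Implicit Defensive.

Import GRing.Theory.
Local Open Scope classical_set_scope.
Local Open Scope ring_scope.

Section GradedModules.
Variables (K : fieldType) (r : nat).
Local Notation S := {mpoly K[r]}.

(* A Z-graded module over the standard graded polynomial ring S: the last two
   fields say that it is the (internal) direct sum of its components, which are
   K-subspaces by gm_add and by gm_act with homogeneous p of degree 0. *)
Record gradedModule := GradedModule {
  gm_sort :> lmodType S;
  gm_comp : int -> set gm_sort;
  gm_zero : forall d, gm_comp d 0;
  gm_add : forall d u v, gm_comp d u -> gm_comp d v -> gm_comp d (u + v);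
  gm_act : forall (e : nat) d (p : S) v,
    p \is e.-homog -> gm_comp d v -> gm_comp (d + e%:Z) (p *: v);
  gm_sum : forall v, exists (F : int -> gm_sort) (s : seq int),
    (forall d, gm_comp d (F d)) /\ v = \sum_(d <- s) F d;
  gm_direct : forall (F : int -> gm_sort) (s : seq int),
    uniq s -> (forall d, gm_comp d (F d)) -> \sum_(d <- s) F d = 0 ->
    forall d, d \in s -> F d = 0
}.

Definition finitely_generated (N : lmodType S) : Prop :=
  exists g : seq N, forall v : N,
    exists c : nat -> S, v = \sum_(i < size g) c i *: g`_i.

(* k is the K-dimension of the K-subspace V of N *)
Definition is_dim (N : lmodType S) (V : set N) (k : nat) : Prop :=
  exists b : 'I_k -> N, (forall i, V (b i)) /\
    forall v, V v ->
      exists! c : {ffun 'I_k -> K}, v = \sum_(i < k) (c i)%:MP *: b i.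

Definition dimK (N : lmodType S) (V : set N) : nat := xget 0%N (is_dim V).

(* The Hilbert series sum_d (dim_K N_d) t^d, given by its coefficients; junk
   value 0 at infinite-dimensional components, which do not occur in finitely
   generated modules. *)
Definition hilbert_series (N : gradedModule) : int -> nat :=
  fun d => dimK (@gm_comp N d).

(* The submodule (f_1, ..., f_k) N *)
Definition idealM (f : seq S) (N : lmodType S) : set N :=
  [set v | exists w : nat -> N, v = \sum_(i < size f) f`_i *: w i].

(* The ideal generated by f: the case where N is S itself *)
Definition ideal (f : seq S) : set S := @idealM f S^o.

Definition max_ideal : set S := ideal [seq 'X_i | i : 'I_r].

(* Each f_i is a nonzerodivisor on N / (f_1, ..., f_(i-1)) N, and
   N / (f_1, ..., f_k) N is nonzero. *)
Definition regular_seq (N : lmodType S) (f : seq S) : Prop :=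
  (forall (i : nat) (v : N), (i < size f)%N ->
     idealM (take i f) (f`_i *: v) -> idealM (take i f) v) /\
  (exists v : N, ~ idealM f v).

(* The maximal length of an N-regular sequence in max_ideal. The supremum is
   attained for finitely generated N <> 0; for N = 0 it is that of the empty
   set, here 0. *)
Definition depth (N : lmodType S) : nat :=
  supremum 0%N [set k | exists f : seq S,
    [/\ size f = k, {in f, forall p, max_ideal p} & regular_seq N f]].

Definition hdepth (M : gradedModule) : nat :=
  supremum 0%N [set k | exists N : gradedModule,
    [/\ finitely_generated N, hilbert_series N = hilbert_series M
      & depth N = k]].

Section Quotient.
Variable s : seq S.

Definition ideal_pred : S -> bool := fun p => `[< ideal s p >].

Lemma ideal_predM a p : p \in ideal_pred -> a * p \in ideal_pred.
Proof.
move=> /asboolP[w ->]; apply/asboolP; exists (fun i => a * (w i : S)).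
rewrite mulr_sumr; apply: eq_bigr => i _; exact: mulrCA.
Qed.

Lemma ideal_pred_zmod : zmod_closed ideal_pred.
Proof.
split.
  apply/asboolP; exists (fun=> 0); rewrite big1 // => i _; exact: mulr0.
move=> p q /asboolP[w ->] /asboolP[w' ->]; apply/asboolP.
exists (fun i => w i - w' i); rewrite -sumrB.
by apply: eq_bigr => i _; rewrite scalerBr.
Qed.

HB.instance Definition _ := GRing.isZmodClosed.Build S ideal_pred ideal_pred_zmod.
Definition ideal_zmod : zmodClosed S := GRing.ZmodClosed.clone S ideal_pred _.

Definition quot_module : Type := @Quotient.quot S ideal_zmod.
HB.instance Definition _ := GRing.Zmodule.on quot_module.

Definition quot_pi (p : S) : quot_module := \pi_(@Quotient.quot S ideal_zmod)%qT p.

Lemma quot_piB : {morph quot_pi : p q / p - q}.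
Proof. exact: raddfB. Qed.

HB.instance Definition _ :=
  GRing.isZmodMorphism.Build S quot_module quot_pi quot_piB.

Lemma quot_piP p q : quot_pi p = quot_pi q <-> ideal s (p - q).
Proof.
split=> [/eqP|/asboolP H]; last by apply/eqP; rewrite -Quotient.idealrBE.
by rewrite -Quotient.idealrBE => /asboolP.
Qed.

Lemma quot_pi_surj (v : quot_module) : exists p, v = quot_pi p.
Proof. by exists (repr (v : @Quotient.quot S ideal_zmod)); rewrite /quot_pi reprK. Qed.

Definition quot_scale (a : S) (v : quot_module) : quot_module :=
  quot_pi (a * repr (v : @Quotient.quot S ideal_zmod)).

Lemma quot_scaleE a p : quot_scale a (quot_pi p) = quot_pi (a * p).
Proof.
apply/quot_piP; rewrite -mulrBr; apply/asboolP/ideal_predM/asboolP.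
by apply/quot_piP; rewrite /quot_pi reprK.
Qed.

Lemma quot_scaleA a b v : quot_scale a (quot_scale b v) = quot_scale (a * b) v.
Proof. by have [p ->] := quot_pi_surj v; rewrite !quot_scaleE mulrA. Qed.

Lemma quot_scale1 : left_id 1 quot_scale.
Proof. by move=> v; have [p ->] := quot_pi_surj v; rewrite quot_scaleE mul1r. Qed.

Lemma quot_scaleDr : right_distributive quot_scale +%R.
Proof.
move=> a u v; have [p ->] := quot_pi_surj u; have [q ->] := quot_pi_surj v.
by rewrite -raddfD !quot_scaleE mulrDr raddfD.
Qed.

Lemma quot_scaleDl v : {morph quot_scale^~ v : a b / a + b}.
Proof.
by move=> a b; have [p ->] := quot_pi_surj v; rewrite !quot_scaleE mulrDl raddfD.
Qed.

HB.instance Definition _ := GRing.Zmodule_isLmodule.Build S quot_module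
  quot_scaleA quot_scale1 quot_scaleDr quot_scaleDl.

Definition quot_comp (d : int) : set quot_module :=
  match d with
  | Posz k => [set v | exists2 p : S, p \is k.-homog & v = quot_pi p]
  | Negz _ => [set 0]
  end.

Hypothesis homs : {in s, forall p : S, p \is homog mdeg}.

Lemma pihomogMr d e (p q : S) : q \is e.-homog ->
  pihomog mdeg d (p * q) =
    if (e <= d)%N then pihomog mdeg (d - e) p * q else 0.
Proof.
move=> hq; rewrite {1}[p](pihomog_partitionE (leqnn (mmeasure mdeg p))).
rewrite mulr_suml raddf_sum /=.
have E (i : nat) : pihomog mdeg d (pihomog mdeg i p * q) =
    if (i + e == d)%N then pihomog mdeg i p * q else 0.
  have h : pihomog mdeg i p * q \is (i + e).-homog by exact/dhomogM/hq/pihomogP.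
  by case: eqP => [<-|/eqP ne]; [exact: pihomog_dE|exact: (pihomog_ne0 ne)].
under eq_bigr do rewrite E; case: leqP => [ed|de]; last first.
  by rewrite big1 // => i _; case: eqP => // H; move: de; rewrite -H ltnNge leq_addl.
rewrite -big_mkcond /=.
case: (ltnP (d - e) (mmeasure mdeg p)) => [lt|ge].
  rewrite (big_pred1 (Ordinal lt)) // => i /=.
  by rewrite -val_eqE /= -[in RHS](eqn_add2r e) (subnK ed).
rewrite big_pred0 => [|i]; last first.
  apply/negP => /eqP H; have := ltn_ord i; rewrite ltnNge => /negP; apply.
  by rewrite -H addnK in ge.
rewrite {1}[p](pihomog_partitionE (leqnn (mmeasure mdeg p))) raddf_sum /=.
rewrite big1 ?mul0r // => i _.
apply: (@pihomog_ne0 _ _ _ i); last exact: pihomogP.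
by rewrite neq_ltn (leq_trans (ltn_ord i) ge).
Qed.

Lemma ideal_pihomog d p : ideal s p -> ideal s (pihomog mdeg d p).
Proof.
case=> w ->; rewrite raddf_sum /=; apply/asboolP.
apply: (@rpred_sum _ ideal_zmod) => i _.
have /homogP[e he] := homs (mem_nth 0 (ltn_ord i)).
have -> : s`_i *: w i = (w i : S) * s`_i by exact: mulrC.
rewrite (pihomogMr _ _ he); case: ifP => _; last exact: (@rpred0 _ ideal_zmod).
apply: ideal_predM; apply/asboolP.
exists (fun j : nat => ((j == i :> nat)%:R : S)).
rewrite (bigD1 i) //= eqxx big1 ?addr0 => [|j ji].
  by rewrite -[RHS]/(s`_i * 1) mulr1.
by rewrite -val_eqE in ji; rewrite (negPf ji) -[LHS]/(s`_j * 0) mulr0.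
Qed.

Lemma quot_comp0 d : quot_comp d 0.
Proof. by case: d => k //=; exists 0; rewrite ?raddf0 ?rpred0. Qed.

Lemma quot_compD d u v : quot_comp d u -> quot_comp d v -> quot_comp d (u + v).
Proof.
case: d => k /=; last by move=> -> ->; exact: addr0.
by case=> p hp -> [q hq ->]; exists (p + q); rewrite ?rpredD ?raddfD.
Qed.

Lemma quot_comp_act (e : nat) d (p : S) v :
  p \is e.-homog -> quot_comp d v -> quot_comp (d + e%:Z) (p *: v).
Proof.
move=> hp; case: d => k /=; last by move=> ->; rewrite scaler0; exact: quot_comp0.
case=> q hq ->; exists (q * p); first exact: dhomogM.
by rewrite -[LHS]/(quot_scale p _) quot_scaleE mulrC.
Qed.

Lemma quot_comp_sum v : exists (F : int -> quot_module) (t : seq int),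
  (forall d, quot_comp d (F d)) /\ v = \sum_(d <- t) F d.
Proof.
have [p ->] := quot_pi_surj v.
exists (fun d => if d is Posz k then quot_pi (pihomog mdeg k p) else 0).
exists [seq Posz k | k <- iota 0 (mmeasure mdeg p)]; split.
  by case=> k //=; exists (pihomog mdeg k p) => //; exact: pihomogP.
rewrite big_map {1}[p](pihomog_partitionE (leqnn (mmeasure mdeg p))) raddf_sum.
by rewrite -[in RHS](subn0 (mmeasure mdeg p)) big_mkord.
Qed.

Lemma quot_comp_direct (F : int -> quot_module) (t : seq int) :
  uniq t -> (forall d, quot_comp d (F d)) -> \sum_(d <- t) F d = 0 ->
  forall d, d \in t -> F d = 0.
Proof.
move=> ut hF sF d dt.
have /choice[f hf] : forall d, exists p : S, quot_pi p = F d /\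
    if d is Posz k then p \is k.-homog else p = 0.
  move=> c; have := hF c; case: c => k /=; last by move=> ->; exists 0; rewrite raddf0.
  by case=> p hp ->; exists p.
case: d dt => k dt; last exact: (hF (Negz k)).
have /(ideal_pihomog k) : ideal s (\sum_(d <- t) f d).
  rewrite -[X in ideal s X]subr0; apply/quot_piP; rewrite raddf0 raddf_sum -[RHS]sF.
  by apply: eq_bigr => c _; case: (hf c).
rewrite raddf_sum (bigD1_seq (Posz k)) //= big1 => [|c ck].
  rewrite addr0 pihomog_dE; last by case: (hf (Posz k)).
  rewrite -{1}[f _]subr0 => /quot_piP; rewrite raddf0 => <-.
  by case: (hf (Posz k)).
case: c ck => c ck; last by have [_ ->] := hf (Negz c); rewrite raddf0.
have [_ hc] := hf (Posz c).
by apply: (pihomog_ne0 _ hc); apply: contraNneq ck => ->.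
Qed.

(* S/(s) with the grading induced from S *)
Definition graded_quot : gradedModule :=
  GradedModule quot_comp0 quot_compD quot_comp_act quot_comp_sum quot_comp_direct.

End Quotient.
End GradedModules.

(* The generators x_i y_j, where x_i and y_j are the first n and the last m
   variables of K[x_1, ..., x_n, y_1, ..., y_m] = {mpoly K[n + m]}. *)
Definition xy_gens (K : fieldType) (n m : nat) : seq {mpoly K[n + m]} :=
  [seq 'X_(lshift m i) * 'X_(rshift n j) | i <- enum 'I_n, j <- enum 'I_m].

Lemma xy_gens_homog (K : fieldType) (n m : nat) :
  {in xy_gens K n m, forall p : {mpoly K[n + m]}, p \is homog mdeg}.
Proof.
move=> _ /allpairsP[[i j] [_ _ ->]] /=; apply/homogP; exists (1 + 1)%N.
by apply: dhomogM; rewrite dhomogX /= mdeg1.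
Qed.

(* h(n, m) = hdepth(S_{n,m} / I_{n,m}) *)
Definition hdepth_xy (K : fieldType) (n m : nat) : nat :=
  hdepth (graded_quot (@xy_gens_homog K n m)).

(* Main.v *)
(** Lower bound: the Hilbert series 1/(1-t)^n + 1/(1-t)^m - 1 of S/I is, for
    r = floor(n/2), a nonnegative combination of series t^e/(1-t)^j with
    r <= j <= n; the corresponding direct sum of shifted polynomial rings has
    x_1, ..., x_r as a regular sequence.

    Upper bound: if f_1, ..., f_k is regular on N, in the maximal ideal but
    possibly inhomogeneous, then k generic linear forms l_i = sum_a t_i^a x_a are
    regular on N[t_1, ..., t_k]. Indeed, if N/Q has trivial socle then a McCoy
    argument makes l regular on N[t]/Q[t], and l can be moved in front of the
    f_i. Counting ranks in each degree, the coefficients of (1-t)^k H_N(t) are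
    nonnegative. For k = n/2 + O(n^(3/4)) the coefficient of t^d with d even of
    order n^(3/4) is negative. *)

Require Import Defs.
From HB Require Import structures.
From mathcomp Require Import all_boot all_order all_algebra.
From mathcomp Require Import boolp classical_sets functions.
From mathcomp Require Import zify.
From mathcomp.multinomials Require mpoly.
Set Implicit Arguments.
Unset Strict Implicit.
Unset Printing Implicit Defensive.

Import Order.TTheory GRing.Theory Num.Theory.
Local Open Scope ring_scope.

(** * Generic linear forms *)

(** The obstacle is that [depth] admits inhomogeneous sequences and that K may be finite, so N
    itself need not have a regular sequence of linear forms. An indeterminate t supplies a generic
    form over every K, and one t per form is enough: the powers t^a keep the McCoy argument
    univariate. A form l can pass in front of f_1, ..., f_(k-1) because it is regular modulo each
    initial segment f_1, ..., f_i with i < k: there f_(i+1) is a regular element of the ideal of the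
    variables, so the socle is trivial. And if f, l is regular and l is regular, then so is l, f.
    Each round therefore gives up the last f and gains one form. Adjoining the t_i replaces K by the
    domain K[t_1, ..., t_k]. The graded pieces of N become free modules of unchanged rank, and ranks
    over the fraction field take over the role of dimensions. For the rate, put a = n - k and k = a
    + d + s. Negativity of the coefficient of t^d follows from roughly a^2 <= s d^2. With w near
    n^(1/4), the choice of d = 2 w^3 and s near w^2 achieves this in integers, and d + s = o(n). *)

Section WeaklyRegular.
Variables (A : comNzRingType).

Definition submodP (M : lmodType A) (Q : M -> Prop) :=
  Q 0 /\ forall a u v, Q u -> Q v -> Q (a *: u + v).

(** Sequences consist of operators rather than ring elements because the generic form involves t,
    while M[t] is kept as a module over A alone, so that t never is a scalar. *)
Definition linop (M : lmodType A) (f : M -> M) :=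
  forall a u v, f (a *: u + v) = a *: f u + f v.

(* the membership predicate of Q + f M *)
Definition addim (M : lmodType A) (f : M -> M) (Q : M -> Prop) (v : M) :=
  exists w, Q (v - f w).

(* The implication from right to left says that Q is stable under f. Asking for
   both is what makes the rank count below additive. *)
Fixpoint wreg (M : lmodType A) (Q : M -> Prop) (s : seq (M -> M)) : Prop :=
  if s is f :: s' then (forall v, Q (f v) <-> Q v) /\ wreg (addim f Q) s'
  else True.

Section Submod.
Variables (M : lmodType A) (Q : M -> Prop) (sQ : submodP Q).

Lemma submodP0 : Q 0. Proof. by case: sQ. Qed.
Lemma submodPD u v : Q u -> Q v -> Q (u + v).
Proof. by move=> qu qv; rewrite -[u]scale1r; apply: (sQ.2). Qed.
Lemma submodPZ a u : Q u -> Q (a *: u).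
Proof. by move=> qu; rewrite -[_ *: _]addr0; apply: (sQ.2) => //; case: sQ. Qed.
Lemma submodPN u : Q u -> Q (- u).
Proof. by move=> qu; rewrite -scaleN1r; apply: submodPZ. Qed.
Lemma submodP_sum (I : Type) (s : seq I) (P : pred I) F :
  (forall i, P i -> Q (F i)) -> Q (\sum_(i <- s | P i) F i).
Proof. by move=> h; elim/big_ind: _ => //; [exact: submodP0|exact: submodPD]. Qed.
Lemma submodP_cong u v : Q (u - v) -> Q v -> Q u.
Proof. by move=> h qv; rewrite -(subrK v u); apply: submodPD. Qed.
End Submod.

Lemma linopB (M : lmodType A) (f : M -> M) : linop f ->
  forall u v, f (u - v) = f u - f v.
Proof. by move=> lf u v; rewrite addrC -scaleN1r lf scaleN1r addrC. Qed.

Lemma linop0 (M : lmodType A) (f : M -> M) : linop f -> f 0 = 0.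
Proof. by move=> lf; rewrite -[X in f X](subrr 0) linopB // subrr. Qed.

Lemma linop_scale (M : lmodType A) (a : A) : linop (fun v : M => a *: v).
Proof. by move=> b u v; rewrite scalerDr !scalerA mulrC. Qed.

Lemma addim_submod (M : lmodType A) (f : M -> M) (Q : M -> Prop) :
  linop f -> submodP Q -> submodP (addim f Q).
Proof.
move=> lf sQ; split.
  by exists 0; rewrite linop0 // subrr; case: sQ.
move=> a u v [w hw] [w' hw']; exists (a *: w + w').
rewrite lf (_ : _ - _ = a *: (u - f w) + (v - f w')); first exact: (sQ.2).
by rewrite scalerBr opprD addrACA.
Qed.

Lemma addim_sub (M : lmodType A) (f : M -> M) (Q : M -> Prop) v :
  linop f -> Q v -> addim f Q v.
Proof. by move=> lf qv; exists 0; rewrite linop0 // subr0. Qed.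

Lemma addim_ext (M : lmodType A) (f : M -> M) (Q Q' : M -> Prop) :
  (forall v, Q v <-> Q' v) -> forall v, addim f Q v <-> addim f Q' v.
Proof. by move=> h v; split=> -[w /h hw]; exists w. Qed.

Lemma wreg_ext (M : lmodType A) s (Q Q' : M -> Prop) :
  (forall v, Q v <-> Q' v) -> wreg Q s -> wreg Q' s.
Proof.
elim: s Q Q' => //= f s IH Q Q' h [rf rs]; split.
  by move=> v; rewrite -!h.
by apply: IH rs; apply: addim_ext.
Qed.

Lemma addimC (M : lmodType A) (f g : M -> M) (Q : M -> Prop) v :
  addim f (addim g Q) v <-> addim g (addim f Q) v.
Proof. by split=> -[w [w' h]]; exists w', w; rewrite addrAC. Qed.

Lemma wreg_cat (M : lmodType A) s s' (Q : M -> Prop) :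
  wreg Q (s ++ s') <->
  wreg Q s /\ wreg (foldl (fun Q f => addim f Q) Q s) s'.
Proof. by elim: s Q => [|f s IH] Q /=; rewrite ?IH; tauto. Qed.

End WeaklyRegular.

Section Coefficients.
Variables (A : comNzRingType) (M : lmodType A).

Definition fin_supp : pred (nat -> M) :=
  fun v => `[< exists n, forall i, (n <= i)%N -> v i = 0 >].

Lemma fin_supp_submod : GRing.submod_closed fin_supp.
Proof.
split; first by apply/asboolP; exists 0%N.
move=> a u v /asboolP[n hn] /asboolP[k hk]; apply/asboolP.
exists (maxn n k) => i; rewrite geq_max => /andP[ni ki].
by rewrite -[LHS]/(a *: u i + v i) hn // hk // scaler0 addr0.
Qed.

HB.instance Definition _ :=
  GRing.isSubmodClosed.Build A (nat -> M) fin_supp fin_supp_submod.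

(* M[t] *)
Record polym := PolyM { polym_coef :> nat -> M; _ : polym_coef \in fin_supp }.

HB.instance Definition _ := [isSub for polym_coef].
HB.instance Definition _ := [Choice of polym by <:].
HB.instance Definition _ := [SubChoice_isSubLmodule of polym by <:].

Lemma polymD (u v : polym) n : (u + v) n = u n + v n. Proof. by []. Qed.
Lemma polymB (u v : polym) n : (u - v) n = u n - v n. Proof. by []. Qed.
Lemma polymZ a (u : polym) n : (a *: u) n = a *: u n. Proof. by []. Qed.
Lemma polym0 n : (0 : polym) n = 0. Proof. by []. Qed.

Lemma polym_bound (v : polym) : exists n, forall i, (n <= i)%N -> v i = 0.
Proof. by apply/asboolP; case: v. Qed.

Lemma polymP (u v : polym) : (forall n, u n = v n) -> u = v.
Proof. by move=> h; apply: val_inj; apply/funext. Qed.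

(** The default 0 is taken when [v] has infinite support; [topolymE] asks for a bound on the support
    to exclude this. *)
Definition topolym (v : nat -> M) : polym := insubd 0 v.

Lemma topolymE (v : nat -> M) n : (forall i, (n <= i)%N -> v i = 0) ->
  forall i, topolym v i = v i.
Proof. by move=> h i; rewrite -[LHS]/(val (topolym v) i) insubdK //; apply/asboolP; exists n. Qed.

Definition coefQ (Q : M -> Prop) (v : polym) := forall n, Q (v n).

Lemma coefQ_submod Q : submodP Q -> submodP (coefQ Q).
Proof. by move=> sQ; split=> [|a u v hu hv] n; [exact: (sQ.1)|exact: (sQ.2)]. Qed.

Definition mapop (f : M -> M) (v : polym) : polym := topolym (fun n => f (v n)).

Lemma mapopE f (v : polym) n : linop f -> mapop f v n = f (v n).
Proof.
move=> lf; have [k hk] := polym_bound v.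
by apply: (@topolymE _ k) => i /hk ->; rewrite linop0.
Qed.

Lemma mapop_lin f : linop f -> linop (mapop f).
Proof. by move=> lf a u v; apply: polymP => n; rewrite polymD polymZ !mapopE // lf. Qed.

Lemma mapop_scale a v : mapop (fun v => a *: v) v = a *: v.
Proof. by apply: polymP => n; rewrite mapopE //; apply: linop_scale. Qed.

Lemma coefQ_addim f Q : linop f -> submodP Q ->
  forall v, coefQ (addim f Q) v <-> addim (mapop f) (coefQ Q) v.
Proof.
move=> lf sQ v; split; last first.
  by case=> w hw n; exists (w n); have := hw n; rewrite polymB mapopE.
move=> h; have [k hk] := polym_bound v.
(* The preimages are chosen to be 0 beyond the support of [v], so that together they form an element
   of M[t]. *)
have /choice[w hw] : forall n, exists w, Q (v n - f w) /\ ((k <= n)%N -> w = 0).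
  move=> n; case: (leqP k n) => kn; last by have [w ?] := h n; exists w.
  by exists 0; rewrite hk // linop0 // subrr; split=> //; apply: (sQ.1).
exists (topolym w) => n; rewrite polymB mapopE // (@topolymE _ k) //.
  by case: (hw n).
by move=> i; apply: (hw i).2.
Qed.

Lemma wreg_coef Q s : submodP Q -> (forall i, linop (nth id s i)) ->
  wreg Q s -> wreg (coefQ Q) [seq mapop f | f <- s].
Proof.
elim: s Q => //= f s IH Q sQ ls [rf rs].
have lf : linop f := ls 0%N.
split.
  by move=> v; split=> h n; have := h n; rewrite mapopE // rf.
apply: wreg_ext (IH _ _ (fun i => ls i.+1) rs); last exact: addim_submod.
exact: coefQ_addim.
Qed.

Variables (r : nat) (x : 'I_r -> A).

(* multiplication by the generic linear form \sum_a t^a x_a *)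
Definition genlin (v : polym) : polym :=
  topolym (fun n => \sum_(a < r | (a <= n)%N) x a *: v (n - a)%N).

Lemma genlinE v n : genlin v n = \sum_(a < r | (a <= n)%N) x a *: v (n - a)%N.
Proof.
have [k hk] := polym_bound v.
apply: (@topolymE _ (k + r)) => i hi; apply: big1 => a _.
rewrite hk ?scaler0 // leq_subRL; last first.
  by apply: leq_trans (leq_trans hi _) => //; rewrite (leq_trans (ltnW (ltn_ord a))) // leq_addl.
by apply: leq_trans hi; rewrite addnC leq_add2l ltnW.
Qed.

Lemma genlin_lin : linop genlin.
Proof.
move=> a u v; apply: polymP => n; rewrite polymD polymZ !genlinE.
rewrite scaler_sumr -big_split /=; apply: eq_bigr => i _.
rewrite -[X in _ *: X = _]/(a *: u _ + v _) scalerDr !scalerA mulrC //.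
Qed.

Lemma coefQ_genlin Q v : submodP Q -> coefQ Q v -> coefQ Q (genlin v).
Proof.
by move=> sQ qv n; rewrite genlinE; apply: (submodP_sum sQ) => // a _; apply: (submodPZ sQ).
Qed.

(** Induction on a bound e from which on all coefficients of [v] lie in [Q]. The induction
    hypothesis is used twice: for each x_a v, once x_a is known to send the top coefficient into
    [Q], and for [v] itself, once the socle hypothesis puts its top coefficient in [Q]. *)
Lemma genlin_reg Q : submodP Q -> (forall v, (forall a, Q (x a *: v)) -> Q v) ->
  forall v, coefQ Q (genlin v) -> coefQ Q v.
Proof.
move=> sQ soc v lv.
have [e he] : exists e, forall n, (e <= n)%N -> Q (v n).
  by have [e he] := polym_bound v; exists e => n /he ->; apply: (sQ.1).
(* McCoy: the x_a kill the top coefficient of v mod Q, for a descending from r - 1. *)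
elim: e v he lv => [|e IH] v he lv; first by move=> n; apply: he.
have key : forall a : 'I_r, coefQ Q (x a *: v).
  move=> a; have [k] := ubnP (r - a)%N; elim: k a => // k IHk a ak.
  have qa : Q (x a *: v e).
    have := lv (a + e)%N; rewrite genlinE (bigD1 a) ?leq_addr //= addKn.
    move=> H; apply: (submodP_cong sQ _ H); rewrite opprD addrA subrr add0r.
    apply: (submodPN sQ) => //; apply: (submodP_sum sQ) => // b /andP[ble nba].
    case: (ltngtP a b) => ab.
    - apply: (IHk b _ (a + e - b)%N).
      exact: (leq_trans (ltn_sub2l (ltn_ord a) ab) ak).
    - apply: (submodPZ sQ) => //; apply: he.
      by rewrite ltn_subRL ltn_add2r.
    - by move: nba; rewrite -val_eqE /= ab eqxx.
  (* The bound for x_a v has dropped to e, and l (x_a v) = x_a (l v) still has its coefficients in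
     [Q]. *)
  apply: IH.
    move=> n; rewrite leq_eqVlt polymZ => /orP[/eqP <-//|/he hn].
    exact: (submodPZ sQ).
  rewrite -[_ *: v]addr0 genlin_lin => n; rewrite polymD polymZ.
  apply: (submodPD sQ) => //; first exact: (submodPZ sQ).
  rewrite genlinE big1 => [|i _]; first exact: sQ.1.
  by rewrite polym0 scaler0.
apply: IH => // n; rewrite leq_eqVlt => /orP[/eqP <-|/he //].
by apply: soc => a; apply: key.
Qed.

Definition in_ideal (f : A) := exists c : 'I_r -> A, f = \sum_a c a * x a.

(** A class killed by every x_a is killed by any combination of them, in particular by the regular
    element [f]. *)
Lemma in_ideal_soc Q (f : A) : submodP Q -> in_ideal f ->
  (forall v : M, Q (f *: v) -> Q v) ->
  forall v, (forall a, Q (x a *: v)) -> Q v.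
Proof.
move=> sQ [c ->] reg v hv; apply: reg; rewrite scaler_suml.
by apply: (submodP_sum sQ) => // a _; rewrite -scalerA; apply: (submodPZ sQ).
Qed.

Definition scaleops (N : lmodType A) (s : seq A) : seq (N -> N) :=
  [seq (fun v => a *: v) | a <- s].

(** The last element [f] is exchanged for a generic form at the front. Its only task is to make the
    form regular modulo all of [fs]; modulo a shorter initial segment the next element of [fs] does
    this. *)
Lemma genlin_wreg Q (fs : seq A) (f : A) : submodP Q ->
  {in f :: fs, forall g, in_ideal g} ->
  wreg Q (scaleops M (rcons fs f)) ->
  wreg (coefQ Q) (genlin :: scaleops polym fs).
Proof.
have main : forall Q f s, submodP Q -> in_ideal f -> wreg Q (scaleops M (f :: s)) ->
    forall v, coefQ Q (genlin v) <-> coefQ Q v.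
  move=> {}Q {}f s sQ hf [rf _] v; split; last exact: coefQ_genlin.
  by apply: genlin_reg => //; apply: in_ideal_soc hf _ => // w /rf.
move=> sQ hfs rs; split.
  case: fs hfs rs => [|g fs] hfs rs; first by apply: main rs => //; apply: hfs; rewrite mem_head.
  by apply: main rs => //; apply: hfs; rewrite !inE eqxx orbT.
elim: fs Q sQ hfs rs => //= g fs IH Q sQ hfs [rg rs].
have lg : linop (fun v : M => g *: v) by exact: linop_scale.
have lg' : linop (fun v : polym => g *: v) by exact: linop_scale.
have sQ' := addim_submod lg sQ.
have coefg v : coefQ (addim (fun v => g *: v) Q) v <->
    addim (fun v => g *: v) (coefQ Q) v.
  rewrite coefQ_addim //; split=> -[w hw]; exists w; move: hw; rewrite mapop_scale //.
have hfs' : {in f :: fs, forall g, in_ideal g}.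
  by move=> h hin; apply: hfs; move: hin; rewrite !inE => /orP[->//|->]; rewrite !orbT.
have sQl := addim_submod genlin_lin (coefQ_submod sQ).
split; last first.
  apply: wreg_ext (IH _ sQ' hfs' rs) => v.
  by rewrite addimC; apply: addim_ext => u; apply: coefg.
move=> u; split; last exact: (submodPZ sQl).
case=> v hv.
have lreg : forall v, coefQ (addim (fun v => g *: v) Q) (genlin v) ->
    coefQ (addim (fun v => g *: v) Q) v.
  move=> w; case: (fs) rs hfs' => [|g' fs'] rs hfs' /(main _ _ _ sQ' _ rs); apply.
    by apply: hfs'; rewrite mem_head.
  by apply: hfs'; rewrite !inE eqxx orbT.
(* The exchange: from g u = l v modulo [Q], regularity of l modulo g gives v = g w, hence g (u - l
   w) lies in [Q], and regularity of g gives u = l w modulo [Q]. *)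
have /lreg/coefg[w hw] : coefQ (addim (fun v => g *: v) Q) (genlin v).
  apply/coefg; exists u; rewrite -opprB; exact: (submodPN (coefQ_submod sQ)).
exists w => n; apply/rg.
have E : g *: (u - genlin w) = (g *: u - genlin v) + genlin (v - g *: w).
  rewrite (linopB genlin_lin).
  have -> : genlin (g *: w) = g *: genlin w.
    by have := genlin_lin g w 0; rewrite (linop0 genlin_lin) !addr0.
  by rewrite addrA subrK scalerBr.
rewrite -polymZ E; apply: (submodPD (coefQ_submod sQ)) => //.
exact: coefQ_genlin.
Qed.

End Coefficients.

(** * Rank count *)

Section Fractions.
Variable B : idomainType.
Local Notation F := {fraction B}.
Local Notation tofrac := (@FracField.tofrac B).

Lemma frac_clear (x : F) : exists c y, c != 0 /\ tofrac c * x = tofrac y.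
Proof.
elim/quotW: x => y; exists (frac y).2, (frac y).1.
split; first exact: denom_ratioP.
unlock FracField.tofrac; rewrite -[LHS]FracField.pi_mul.
apply/eqP; rewrite FracField.equivf_def /FracField.mulf !numden_Ratio;
  by rewrite ?mul1r ?mulr1 ?oner_neq0 ?denom_ratioP // mulrC.
Qed.

Lemma frac_clear_mx n (u : 'rV[F]_n) : exists c v, c != 0 /\
  tofrac c *: u = map_mx tofrac v.
Proof.
have /choice[f hf] : forall j, exists cy : B * B, cy.1 != 0 /\
    tofrac cy.1 * u 0 j = tofrac cy.2.
  by move=> j; have [c [y h]] := frac_clear (u 0 j); exists (c, y).
exists (\prod_j (f j).1), (\row_j (\prod_(i | i != j) (f i).1 * (f j).2)).
split; first by apply/prodf_neq0 => j _; case: (hf j).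
apply/rowP => j; rewrite !mxE (bigD1 j) //= mulrC !rmorphM /= -(hf j).2.
by rewrite [RHS]mulrC mulrA [u 0 j * _]mulrC.
Qed.

End Fractions.

(** Multiplication of the generating series of [g] by 1 - t. *)
Definition Dop (g : nat -> int) (d : nat) : int :=
  g d - (if d is d'.+1 then g d' else 0).

Lemma Dop_ext k f g : f =1 g -> iter k Dop f =1 iter k Dop g.
Proof. by elim: k => //= k IH h [|d]; rewrite /Dop !IH. Qed.

(** Additivity of dimension along 0 -> F^m/V -> F^n/W -> F^n/(W + L) -> 0, where the first map is
    multiplication by [L]. The two directions of the hypothesis make that map injective and well
    defined. *)
Lemma rank_adds_inj (F : fieldType) m n p (W : 'M[F]_n) (L : 'M[F]_(m, n))
    (V : 'M[F]_(p, m)) :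
  (forall u : 'rV_m, (u *m L <= W)%MS <-> (u <= V)%MS) ->
  (\rank (W + L)%MS + \rank V = \rank W + m)%N.
Proof.
move=> h.
have kerV : (kermx (L *m cokermx W) :=: V)%MS.
  apply/eqmxP/andP; split; apply/row_subP => i.
    by apply/h; rewrite submxE -mulmxA -row_mul mulmx_ker row0.
  by apply/sub_kermxP; rewrite mulmxA; apply/eqP; rewrite -submxE; apply/h/row_sub.
have kW : (kermx (cokermx W) :=: W)%MS.
  apply/eqmxP/andP; split; last by apply/sub_kermxP; apply: mulmx_coker.
  by rewrite submxE mulmx_ker.
have r1 := mxrank_mul_ker (W + L)%MS (cokermx W).
have r2 := mxrank_ker (L *m cokermx W); rewrite kerV in r2.
rewrite -r1 (eqmxMr _ (addsmxE _ _)) mul_col_mx mulmx_coker -addsmxE adds0mx.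
have -> : \rank ((W + L) :&: kermx (cokermx W))%MS = \rank W.
  rewrite (cap_eqmx (eqmx_refl _) kW); apply/eqmx_rank/andP; split.
    exact: capmxSr.
  by rewrite sub_capmx addsmxSl submx_refl.
by rewrite r2 addnAC subnKC ?rank_leq_row // addnC.
Qed.

Section Model.
Variables (A : comNzRingType) (M : lmodType A) (B : idomainType) (h : nat -> nat).
Variables (pr : forall d, M -> 'rV[B]_(h d)) (e : forall d, 'rV[B]_(h d) -> M).

(* e and pr exhibit the free B-modules B^(h d) as the graded pieces of M, and
   shiftop f says that f has degree 1. *)
Definition is_model := [/\ forall d u v, pr d (u - v) = pr d u - pr d v,
  forall d (u v : 'rV_(h d)), e (u - v) = e u - e v
  & forall d (u : 'rV_(h d)), pr d (e u) = u].

Definition shiftop (f : M -> M) (L : forall d, 'M[B]_(h d, h d.+1)) :=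
  [/\ forall d (u : 'rV_(h d)), f (e u) = e (u *m L d),
  forall d v, pr d.+1 (f v) = pr d v *m L d & forall v, pr 0 (f v) = 0].

Local Notation F := {fraction B}.
Local Notation tofrac := (@FracField.tofrac B).

(** [W d] spans the degree d piece of [Q] over the fraction field, so [h d] minus its rank is the
    rank of that piece of M/Q. Passing from [Q] to Q + f M multiplies the series of these ranks by 1
    - t exactly; after all operators are used, the claim is that a rank is at most [h d]. The
    hypotheses between say that [Q] is graded and that its pieces are stable under B, which being an
    A-submodule does not provide. *)
Lemma wreg_Dop (mod_e : is_model) ls (Q : M -> Prop) (W : forall d, 'M[F]_(h d)) :
  submodP Q ->
  (forall i, linop (nth id ls i)) ->
  (forall i, (i < size ls)%N -> exists L, shiftop (nth id ls i) L) ->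
  (forall d v, Q v -> Q (e (pr d v))) ->
  (forall d (c : B) (u : 'rV_(h d)), Q (e u) -> Q (e (c *: u))) ->
  (forall d (u : 'rV[F]_(h d)), (u <= W d)%MS <->
     exists c v, [/\ c != 0, Q (e v) & tofrac c *: u = map_mx tofrac v]) ->
  wreg Q ls ->
  forall d, 0 <= iter (size ls) Dop (fun d => (h d)%:Z - (\rank (W d))%:Z) d.
Proof.
case: mod_e => prB eB eK.
have eD d (u v : 'rV_(h d)) : e (u + v) = e u + e v.
  by rewrite -[v in LHS]opprK -(sub0r v) !eB -{1}(subrr 0) eB subrr sub0r opprK.
have e0 d : e (0 : 'rV_(h d)) = 0 by rewrite -(subrr 0) eB subrr.
elim: ls Q W => [|f ls IH] Q W sQ lls sls Qpr Qsc QW /=.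
  by move=> _ d; rewrite subr_ge0 lez_nat rank_leq_row.
case=> rf rs d.
have lf : linop f := lls 0%N.
have [L [fe fpr fpr0]] := sls 0%N isT.
have WQ d' (u : 'rV[F]_(h d')) c : c != 0 -> (u <= W d')%MS <-> (tofrac c *: u <= W d')%MS.
  by move=> c0; rewrite (eqmx_scale u) ?tofrac_eq0.
have QWe d' (v : 'rV[B]_(h d')) : (map_mx tofrac v <= W d')%MS <->
    exists2 c, c != 0 & Q (e (c *: v)).
  rewrite QW; split=> [[c [w [c0 qw E]]]|[c c0 q]].
    exists c => //; rewrite (_ : c *: v = w) //.
    apply/rowP => j; have /rowP/(_ j) := E; rewrite !mxE -rmorphM => /eqP.
    by rewrite tofrac_eq => /eqP.
  by exists c, (c *: v); split=> //; rewrite map_mxZ.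
(* An operator of degree 1 has no image in degree 0, so the span changes only from degree 1 on. *)
pose W' d' : 'M[F]_(h d') := match d' with
  | 0 => W 0%N | d''.+1 => (W d''.+1 + map_mx tofrac (L d''))%MS end.
have rkW' d' : (\rank (W' d'.+1) + \rank (W d') = \rank (W d'.+1) + h d')%N.
  apply: rank_adds_inj => u; split.
    have [c [v [c0 cv]]] := frac_clear_mx u.
    rewrite (WQ _ (u *m _) c c0) scalemxAl cv -map_mxM => /QWe[c' c'0].
    rewrite scalemxAl -fe => /rf q; apply/(WQ _ _ c c0); rewrite cv.
    by apply/QWe; exists c'.
  case/QW => c [v [c0 qv E]]; apply/(WQ _ _ c c0).
  rewrite scalemxAl E -map_mxM; apply/QWe; exists 1; rewrite ?oner_neq0 // scale1r -fe.
  by apply/rf.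
rewrite -[Dop (iter _ _ _)]/(iter (size ls).+1 Dop _) iterSr.
have -> : iter (size ls) Dop (Dop (fun d => (h d)%:Z - (\rank (W d))%:Z)) d =
    iter (size ls) Dop (fun d => (h d)%:Z - (\rank (W' d))%:Z) d.
  apply: Dop_ext => -[|d']; rewrite /Dop; first by rewrite subr0.
  have /(congr1 Posz) := rkW' d'; rewrite !PoszD => /(canRL (addrK _)) ->.
  by rewrite !opprD !opprK !addrA addrAC.
move: d; apply: (IH (addim f Q)) => //.
- exact: addim_submod.
- by move=> i; apply: (lls i.+1).
- by move=> i; apply: (sls i.+1).
- move=> d v [w hw]; have := Qpr d _ hw; rewrite prB eB.
  case: d => [|d]; rewrite ?fpr0 ?fpr -?fe; last by exists (e (pr d w)).
  by move=> q; apply: addim_sub => //; rewrite e0 subr0 in q.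
- move=> d c u [w /(Qpr d)]; rewrite prB eK => /(Qsc d c); rewrite scalerBr eB.
  case: d u => [|d] u; rewrite ?fpr0 ?fpr ?scaler0 ?scalemxAl -?fe; last by exists (e (c *: pr d w)).
  by move=> q; apply: addim_sub => //; rewrite e0 subr0 in q.
move=> d u; split.
  case: d u => [|d] u /=.
    by case/QW => c [v [c0 qv E]]; exists c, v; split=> //; apply: addim_sub.
  case/sub_addsmxP => -[w1 w2] /= ->.
  have /QW[c [v [c0 qv E]]] := submxMl w1 (W d.+1).
  have [c2 [v2 [c20 E2]]] := frac_clear_mx w2.
  exists (c * c2), (c2 *: v + c *: v2 *m L d); split; first by rewrite mulf_neq0.
    by rewrite eD -fe; exists (e (c *: v2)); rewrite addrK; apply: Qsc.
  rewrite map_mxD map_mxZ map_mxM map_mxZ -E -E2 scalerDr rmorphM /= !scalerA.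
  by rewrite [_ c2 * _]mulrC !scalemxAl.
case=> c [v [c0 [w hw] E]].
have W'sc : (u <= W' d)%MS = (tofrac c *: u <= W' d)%MS.
  by rewrite (eqmx_scale u) // tofrac_eq0.
rewrite W'sc E; have := Qpr d _ hw; rewrite prB eK.
case: d u v E hw W'sc => [|d] u v E hw W'sc; rewrite ?fpr0 ?fpr /= => q.
  by apply/QWe; exists 1; rewrite ?oner_neq0 // scale1r; rewrite subr0 in q.
rewrite -(subrK (pr d w *m L d) v) map_mxD; apply: addmx_sub_adds.
  by apply/QWe; exists 1; rewrite ?oner_neq0 // scale1r.
by rewrite map_mxM submxMl.
Qed.

End Model.

(** * Free graded pieces after adjoining an indeterminate *)

Section PolynomialModel.
Variables (A : comNzRingType) (M : lmodType A) (B : idomainType) (h : nat -> nat).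
Variables (pr : forall d, M -> 'rV[B]_(h d)) (e : forall d, 'rV[B]_(h d) -> M).
Hypothesis mod_e : is_model pr e.

Let prB d : forall u v, pr d (u - v) = pr d u - pr d v.
Proof. by case: mod_e. Qed.
Let eB d : forall u v : 'rV_(h d), e (u - v) = e u - e v.
Proof. by case: mod_e. Qed.
Let eK d : forall u : 'rV_(h d), pr d (e u) = u.
Proof. by case: mod_e. Qed.

Lemma model_pr0 d : pr d 0 = 0. Proof. by rewrite -(subrr 0) prB subrr. Qed.
Lemma model_e0 d : e (0 : 'rV_(h d)) = 0. Proof. by rewrite -(subrr 0) eB subrr. Qed.
Lemma model_prD d u v : pr d (u + v) = pr d u + pr d v.
Proof. by rewrite -[v in LHS]opprK -(sub0r v) !prB model_pr0 sub0r opprK. Qed.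
Lemma model_eD d (u v : 'rV_(h d)) : e (u + v) = e u + e v.
Proof. by rewrite -[v in LHS]opprK -(sub0r v) !eB model_e0 sub0r opprK. Qed.

Definition rowcoef (i n : nat) (u : 'rV[{poly B}]_n) : 'rV[B]_n := \row_j (u 0 j)`_i.

Lemma rowcoef_bound n (u : 'rV[{poly B}]_n) i :
  (\sum_j size (u 0%R j) <= i)%N -> rowcoef i u = 0.
Proof.
move=> le; apply/rowP => j; rewrite !mxE nth_default //.
by apply: leq_trans le; rewrite (bigD1 j) //= leq_addr.
Qed.

Lemma rowcoefP n (u v : 'rV[{poly B}]_n) : (forall i, rowcoef i u = rowcoef i v) -> u = v.
Proof.
by move=> E; apply/rowP => j; apply/polyP => i; have /rowP/(_ j) := E i; rewrite !mxE.
Qed.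

Lemma rowcoefB i n (u v : 'rV[{poly B}]_n) : rowcoef i (u - v) = rowcoef i u - rowcoef i v.
Proof. by apply/rowP => j; rewrite !mxE coefB. Qed.

Lemma rowcoef_mul i n p (u : 'rV[{poly B}]_n) (L : 'M[B]_(n, p)) :
  rowcoef i (u *m map_mx polyC L) = rowcoef i u *m L.
Proof.
apply/rowP => j; rewrite !mxE coef_sum; apply: eq_bigr => k _.
by rewrite !mxE coefMC.
Qed.

Lemma rowcoef_mulX i n p (u : 'rV[{poly B}]_n) a (L : 'M[B]_(n, p)) :
  rowcoef i (u *m ('X^a *: map_mx polyC L)) =
  if (a <= i)%N then rowcoef (i - a) u *m L else 0.
Proof.
rewrite -scalemxAr; apply/rowP => j; rewrite !mxE coefXnM ltnNge.
by case: leqP => //= ai; rewrite -?rowcoef_mul !mxE.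
Qed.

Lemma rowcoef_sum i n (I : finType) (u : I -> 'rV[{poly B}]_n) :
  rowcoef i (\sum_k u k) = \sum_k rowcoef i (u k).
Proof.
apply/rowP => j; rewrite !mxE summxE coef_sum summxE; apply: eq_bigr => k _.
by rewrite mxE.
Qed.

(** The truncation bound is an arbitrary one, but all coefficients beyond it vanish; [rowcoef_pr]
    describes the result without it. *)
Definition polym_pr d (v : polym M) : 'rV[{poly B}]_(h d) :=
  \row_j \poly_(i < projT1 (cid (polym_bound v))) pr d (v i) 0 j.

Definition polym_e d (u : 'rV[{poly B}]_(h d)) : polym M :=
  topolym (fun i => e (rowcoef i u)).

Lemma rowcoef_pr d v i : rowcoef i (polym_pr d v) = pr d (v i).
Proof.
apply/rowP => j; rewrite !mxE; case: cid => n /= hn; rewrite coef_poly.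
by case: ltnP => // /hn ->; rewrite model_pr0 mxE.
Qed.

Lemma polym_eE d (u : 'rV_(h d)) i : polym_e u i = e (rowcoef i u).
Proof.
apply: (@topolymE _ _ _ (\sum_j size (u 0%R j))) => j le.
by rewrite rowcoef_bound // model_e0.
Qed.

Lemma polym_model : is_model polym_pr polym_e.
Proof.
split.
- by move=> d u v; apply: rowcoefP => i; rewrite rowcoefB !rowcoef_pr polymB prB.
- by move=> d u v; apply: polymP => i; rewrite polymB !polym_eE rowcoefB eB.
- by move=> d u; apply: rowcoefP => i; rewrite rowcoef_pr polym_eE eK.
Qed.

Lemma shiftop_map f L : linop f -> shiftop pr e f L ->
  shiftop polym_pr polym_e (mapop f) (fun d => map_mx polyC (L d)).
Proof.
move=> lf [fe fpr fpr0]; split.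
- by move=> d u; apply: polymP => i; rewrite mapopE // !polym_eE fe rowcoef_mul.
- by move=> d v; apply: rowcoefP => i; rewrite rowcoef_mul !rowcoef_pr mapopE // fpr.
- move=> v; apply: rowcoefP => i; rewrite rowcoef_pr mapopE // fpr0.
  by apply/rowP => j; rewrite !mxE coef0.
Qed.

Lemma shiftop_genlin r (x : 'I_r -> A) (X : 'I_r -> forall d, 'M[B]_(h d, h d.+1)) :
  (forall a, shiftop pr e (fun v => x a *: v) (X a)) ->
  shiftop polym_pr polym_e (genlin x)
    (fun d => \sum_(a < r) 'X^a *: map_mx polyC (X a d)).
Proof.
move=> hX.
have pr_sum d (P : pred 'I_r) (F : 'I_r -> M) :
    pr d (\sum_(a | P a) F a) = \sum_(a | P a) pr d (F a).
  by apply: (big_morph (pr d)); [exact: model_prD|exact: model_pr0].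
have e_sum d (F : 'I_r -> 'rV_(h d)) : e (\sum_a F a) = \sum_a e (F a).
  by apply: (big_morph (@e d)); [exact: model_eD|exact: model_e0].
split.
- move=> d u; apply: polymP => i; rewrite genlinE polym_eE mulmx_sumr rowcoef_sum e_sum.
  rewrite big_mkcond; apply: eq_bigr => a _; rewrite rowcoef_mulX.
  case: leqP => _; last by rewrite model_e0.
  by rewrite polym_eE; case: (hX a) => ->.
- move=> d v; apply: rowcoefP => i; rewrite rowcoef_pr genlinE pr_sum.
  rewrite mulmx_sumr rowcoef_sum big_mkcond; apply: eq_bigr => a _.
  rewrite rowcoef_mulX; case: leqP => // _.
  by rewrite rowcoef_pr; case: (hX a) => _ ->.
- move=> v; apply: rowcoefP => i; rewrite rowcoef_pr genlinE pr_sum big1.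
    by apply/rowP => j; rewrite !mxE coef0.
  by move=> a _; case: (hX a).
Qed.

End PolynomialModel.

Lemma foldl_addim_submod (A : comNzRingType) (M : lmodType A) (ls : seq (M -> M)) Q :
  submodP Q -> (forall i, linop (nth id ls i)) ->
  submodP (foldl (fun Q f => addim f Q) Q ls).
Proof.
elim: ls Q => //= f ls IH Q sQ lls; apply: IH => [|i]; last exact: (lls i.+1).
exact: addim_submod (lls 0%N) sQ.
Qed.

Lemma coefQ_foldl (A : comNzRingType) (M : lmodType A) (ls : seq (M -> M)) Q Q' :
  submodP Q -> (forall i, linop (nth id ls i)) -> (forall v, coefQ Q v <-> Q' v) ->
  forall v, coefQ (foldl (fun Q f => addim f Q) Q ls) v <->
    foldl (fun Q f => addim f Q) Q' [seq mapop f | f <- ls] v.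
Proof.
elim: ls Q Q' => //= f ls IH Q Q' sQ lls QQ'.
have lf : linop f := lls 0%N.
apply: IH => [|i|v]; [exact: addim_submod|exact: (lls i.+1)|].
by rewrite coefQ_addim //; apply: addim_ext.
Qed.

(** Module, base ring and operators are quantified after [fs] because each round of the induction
    changes them: M becomes M[t], B becomes B[t], the last element of [fs] is dropped and a generic
    form is appended to [ls]. The function [h] and the total length stay the same. *)
Theorem wreg_nonneg (A : comNzRingType) (r : nat) (x : 'I_r -> A) (fs : seq A) :
  forall (M : lmodType A) (B : idomainType) (h : nat -> nat)
    (pr : forall d, M -> 'rV[B]_(h d)) (e : forall d, 'rV[B]_(h d) -> M)
    (ls : seq (M -> M)),
  is_model pr e -> (forall a, exists X, shiftop pr e (fun v => x a *: v) X) ->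
  (forall i, linop (nth id ls i)) ->
  (forall i, (i < size ls)%N -> exists L, shiftop pr e (nth id ls i) L) ->
  {in fs, forall f, in_ideal x f} ->
  wreg (fun v : M => v = 0) (ls ++ scaleops M fs) ->
  forall d, 0 <= iter (size ls + size fs) Dop (fun d => (h d)%:Z) d.
Proof.
have zeroS (M : lmodType A) : submodP (fun v : M => v = 0).
  by split=> // a u v -> ->; rewrite scaler0 addr0.
elim/last_ind: fs => [|fs f IH] M B h pr e ls mod_e hx lls sls hfs.
  rewrite cats0 addn0 => wl d.
  have [prB eB eK] := mod_e.
  (* Nothing has been divided out at the start: the count is applied to [Q] = 0, with zero matrices
     as its spans. *)
  rewrite (@Dop_ext _ _ (fun d => (h d)%:Z - (\rank (0 : 'M[{fraction B}]_(h d)))%:Z)).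
    apply: (wreg_Dop mod_e (zeroS M) lls sls) => //.
    - by move=> d' v ->; rewrite (model_pr0 mod_e) (model_e0 mod_e).
    - move=> d' c u /(congr1 (pr d')); rewrite eK (model_pr0 mod_e) => ->.
      by rewrite scaler0 (model_e0 mod_e).
    move=> d' u; rewrite submx0; split=> [/eqP ->|[c [v [c0 ev]]]].
      exists 1, 0; rewrite oner_neq0 (model_e0 mod_e) scaler0; split=> //.
      by rewrite map_mx0.
    have -> : v = 0 by rewrite -[v]eK ev (model_pr0 mod_e).
    by rewrite map_mx0 => /eqP; rewrite scaler_eq0 tofrac_eq0 (negPf c0).
  by move=> d'; rewrite mxrank0 subr0.
case/wreg_cat => wl wf d.
rewrite size_rcons -addSnnS.
have /choice[X hX] := hx.
have lm i : linop (nth id [seq mapop f | f <- ls] i).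
  case: (ltnP i (size ls)) => il; last by rewrite nth_default ?size_map.
  by rewrite (nth_map id) //; apply: mapop_lin.
pose ls' := rcons [seq mapop f | f <- ls] (genlin x).
have -> : (size ls).+1 = size ls' by rewrite size_rcons size_map.
apply: (IH _ _ _ (polym_pr pr) (polym_e e)).
- exact: polym_model.
- move=> a; exists (fun d => map_mx polyC (X a d)).
  have [h1 h2 h3] := shiftop_map mod_e (linop_scale (x a)) (hX a).
  split=> [d' u|d' v|v]; rewrite -?(mapop_scale (x a)).
  + exact: h1.
  + exact: h2.
  + exact: h3.
- move=> i; rewrite nth_rcons; case: ifP => _; first exact: lm.
  by case: ifP => _ //; apply: genlin_lin.
- move=> i; rewrite size_rcons nth_rcons size_map ltnS leq_eqVlt => /orP[/eqP ->|il].
    rewrite ltnn eqxx; exists (fun d => \sum_(a < r) 'X^a *: map_mx polyC (X a d)).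
    exact: shiftop_genlin.
  rewrite il (nth_map id) //; have [L hL] := sls _ il.
  by exists (fun d => map_mx polyC (L d)); apply: shiftop_map.
- by move=> g gin; apply: hfs; rewrite mem_rcons inE gin orbT.
have E0 (v : polym M) : coefQ (fun v => v = 0) v <-> v = 0.
  by split=> [hv|-> //]; apply: polymP => n; rewrite hv.
rewrite cat_rcons; apply/wreg_cat; split.
  apply: wreg_ext (wreg_coef (zeroS M) lls wl); exact: E0.
apply: wreg_ext (coefQ_foldl (zeroS M) lls E0) _.
apply: (genlin_wreg (f := f)) => //; first exact: foldl_addim_submod.
by move=> g gin; apply: hfs; rewrite mem_rcons.
Qed.

(** * Graded modules *)

Section Dimension.
Import mpoly.
Variables (K : fieldType) (r : nat).
Local Notation S := {mpoly K[r]}.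
Implicit Type N : lmodType S.

Definition is_subspace N (V : set N) :=
  V 0 /\ forall (c : K) u v, V u -> V v -> V (c%:MP *: u + v).

Lemma subspace_sum N (V : set N) (I : Type) (s : seq I) (c : I -> K) (b : I -> N) :
  is_subspace V -> (forall i, V (b i)) -> V (\sum_(i <- s) (c i)%:MP *: b i).
Proof.
move=> [V0 VL] hb; elim: s => [|i s IH]; first by rewrite big_nil.
by rewrite big_cons; apply: VL.
Qed.

(** K acts on N only through the constants of S, so the basis is found directly: a spanning family
    of least size is independent, since a nontrivial relation would express one member through the
    others. *)
Lemma is_dim_spanned N (V : set N) (t : seq N) : is_subspace V ->
  {in t, forall u, V u} ->
  (forall v, V v -> forall W : set N, is_subspace W -> {in t, forall u, W u} -> W v) ->
  exists k, is_dim V k.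
Proof.
move=> sV tV span.
pose spanned k := `[< exists b : 'I_k -> N, (forall i, V (b i)) /\
  forall v, V v -> exists c : 'I_k -> K, v = \sum_i (c i)%:MP *: b i >].
have ex : exists k, spanned k.
  exists (size t); apply/asboolP; exists (fun i => t`_i); split.
    by move=> i; apply: tV; apply: mem_nth.
  move=> v Vv; apply: (span v Vv [set v | exists c : 'I_(size t) -> K,
    v = \sum_i (c i)%:MP *: t`_i]%classic).
    split; first by exists (fun=> 0); rewrite big1 // => i _; rewrite mpolyC0 scale0r.
    move=> c u u' [d ->] [d' ->]; exists (fun i => c * d i + d' i).
    rewrite scaler_sumr -big_split; apply: eq_bigr => i _ /=.
    by rewrite scalerA mpolyCD mpolyCM scalerDl.
  move=> u /(nthP 0)[i it <-]; exists (fun j => (i == j :> nat)%:R).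
  rewrite (bigD1 (Ordinal it)) //= eqxx scale1r big1 ?addr0 // => j ne.
  by rewrite eq_sym -[_ == _]/(j == Ordinal it) (negPf ne) mpolyC0 scale0r.
case: (ex_minnP ex) => k /asboolP[b [bV bspan]] kmin.
exists k, b; split=> // v /[dup] Vv /bspan[c cE]; exists [ffun i => c i]; split.
  by rewrite cE; apply: eq_bigr => i _; rewrite ffunE.
move=> c' c'E; apply/ffunP => j.
case: k b bV bspan kmin c cE c' c'E j => [|k] b bV bspan kmin c cE c' c'E j.
  by case: j.
rewrite ffunE; apply/eqP; apply/negPn/negP => ne.
suff /kmin : spanned k by rewrite ltnn.
apply/asboolP.
pose dl i := c i - c' i.
have dl0 : dl j != 0 by rewrite subr_eq0.
have rel : \sum_i (dl i)%:MP *: b i = 0.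
  rewrite -[RHS](subrr v) {1}cE c'E -sumrB; apply: eq_bigr => i _.
  by rewrite mpolyCB scalerBl.
have bj : b j = \sum_(i < k) (- dl (lift j i) / dl j)%:MP *: b (lift j i).
  move: rel; rewrite (bigD1_ord j) //= => /eqP; rewrite addr_eq0 => /eqP E.
  have -> : b j = (dl j)^-1%:MP *: ((dl j)%:MP *: b j).
    by rewrite scalerA -mpolyCM mulVf // scale1r.
  rewrite E scalerN scaler_sumr -sumrN; apply: eq_bigr => i _.
  by rewrite scalerA -mpolyCM -scaleNr -mpolyCN mulNr mulrC.
exists (fun i => b (lift j i)); split=> // u /bspan[d ->].
exists (fun i => d j * (- dl (lift j i) / dl j) + d (lift j i)).
rewrite (bigD1_ord j) //= {1}bj scaler_sumr -big_split; apply: eq_bigr => i _ /=.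
by rewrite scalerA -mpolyCM -scalerDl -mpolyCD.
Qed.

(** The two change of basis matrices have the identity of size k as product, and it factors through
    K^k'. *)
Lemma is_dim_le N (V : set N) k k' : is_dim V k -> is_dim V k' -> (k <= k')%N.
Proof.
move=> [b [bV hb]] [b' [b'V hb']].
have /choice[P hP] : forall i, exists c : {ffun 'I_k' -> K}, b i = \sum_j (c j)%:MP *: b' j.
  by move=> i; have [c [? _]] := hb' _ (bV i); exists c.
have /choice[Q hQ] : forall i, exists c : {ffun 'I_k -> K}, b' i = \sum_j (c j)%:MP *: b j.
  by move=> i; have [c [? _]] := hb _ (b'V i); exists c.
have E : (\matrix_(i, j) P i j) *m (\matrix_(i, j) Q i j) = 1%:M.
  apply/matrixP => i l; rewrite !mxE; have [c [_ cu]] := hb _ (bV i).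
  have e1 : c = [ffun l => \sum_j P i j * Q j l].
    apply: cu; rewrite {1}hP.
    under eq_bigr do rewrite hQ scaler_sumr.
    rewrite exchange_big; apply: eq_bigr => l' _ /=; rewrite ffunE raddf_sum scaler_suml.
    by apply: eq_bigr => j _; rewrite scalerA -mpolyCM.
  have e2 : c = [ffun l => (i == l)%:R].
    apply: cu; rewrite (bigD1 i) //= ffunE eqxx scale1r big1 ?addr0 // => j ne.
    by rewrite ffunE eq_sym (negPf ne) scale0r.
  under eq_bigr do rewrite !mxE.
  by have := congr1 (fun f : {ffun _} => f l) e1; rewrite {1}e2 !ffunE => ->.
by have := mulmx1_min E.
Qed.

Lemma dimK_eq N (V : set N) k : is_dim V k -> dimK V = k.
Proof.
move=> hk; rewrite /dimK; case: xgetP => [k' _ hk'|/(_ k)//].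
by apply/eqP; rewrite eqn_leq !(is_dim_le (V := V)).
Qed.

End Dimension.

Section GradedModule.
Import mpoly.
Variables (K : fieldType) (r : nat) (N : gradedModule K r).
Local Notation S := {mpoly K[r]}.
Local Notation comp := (@gm_comp K r N).

Lemma mpolyC_homog (c : K) : (c%:MP : S) \is 0.-homog.
Proof. by rewrite -[_%:MP]mulr1 mul_mpolyC dhomogZ // dhomog1. Qed.

Lemma comp_subspace d : is_subspace (comp d).
Proof.
split; first exact: gm_zero.
move=> c u v hu hv; apply: gm_add => //.
by have := gm_act (mpolyC_homog c) hu; rewrite addr0.
Qed.

Lemma comp_scaleC d (c : K) v : comp d v -> comp d (c%:MP *: v).
Proof. by move=> hv; have := (comp_subspace d).2 c v 0 hv (gm_zero N d); rewrite addr0. Qed.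

Lemma comp_opp d v : comp d v -> comp d (- v).
Proof. by move=> /(comp_scaleC (-1)); rewrite mpolyCN scaleN1r. Qed.

Definition homdec (v : N) (F : int -> N) := (forall d, comp d (F d)) /\
  exists s : seq int, [/\ uniq s, forall d, d \notin s -> F d = 0 & v = \sum_(d <- s) F d].

Lemma homdec_widen v F (s : seq int) : homdec v F -> uniq s ->
  (forall d, d \notin s -> F d = 0) -> v = \sum_(d <- s) F d.
Proof.
case=> hF [s' [us' h' ->]] us h.
rewrite [LHS](bigID (mem s)) [RHS](bigID (mem s')) /= [X in _ + X]big1 ?addr0; last first.
  by move=> d /h.
rewrite [X in _ = _ + X]big1 ?addr0; last by move=> d /h'.
rewrite -[LHS]big_filter -[RHS]big_filter; apply: perm_big; apply: uniq_perm; rewrite ?filter_uniq // => d.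
by rewrite !mem_filter andbC.
Qed.

Lemma homdec_common v v' F F' : homdec v F -> homdec v' F' ->
  exists s : seq int, [/\ uniq s, v = \sum_(d <- s) F d, v' = \sum_(d <- s) F' d &
    forall d, d \notin s -> F d = 0 /\ F' d = 0].
Proof.
move=> hv hv'; case: (hv) (hv') => hF [s [us hs _]] [hF' [s' [us' hs' _]]].
have out d : d \notin undup (s ++ s') -> F d = 0 /\ F' d = 0.
  by rewrite mem_undup mem_cat negb_or => /andP[/hs -> /hs' ->].
exists (undup (s ++ s')); split; rewrite ?undup_uniq //; apply: homdec_widen => //.
- exact: undup_uniq.
- by move=> d /out[].
- exact: undup_uniq.
- by move=> d /out[].
Qed.

Lemma homdec_uniq v F F' : homdec v F -> homdec v F' -> F = F'.
Proof.
move=> hv hv'; have [s [us e e' out]] := homdec_common hv hv'.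
apply/funext => d; apply/eqP; rewrite -subr_eq0; apply/eqP.
have [ds|/out[-> ->]] := boolP (d \in s); last by rewrite subrr.
apply: (@gm_direct _ _ N (fun d => F d - F' d) s) => //.
  by move=> c; apply: gm_add; [case: hv|apply: comp_opp; case: hv'].
by rewrite sumrB -e -e' subrr.
Qed.

Lemma homdec_ex v : exists F, homdec v F.
Proof.
have [F [s [hF ->]]] := gm_sum v.
(* [gm_sum] may list a degree several times; the multiplicity is moved into the component. *)
exists (fun d => F d *+ count_mem d s); split.
  move=> d; elim: (count_mem d s) => [|n IH]; first exact: gm_zero.
  by rewrite mulrS; apply: gm_add.
exists (undup s); split; first exact: undup_uniq.
  by move=> d; rewrite mem_undup => /count_memPn ->.
rewrite big_undup_iterop_count; apply: eq_bigr => d _.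
by elim: (count_mem d s) => // n; rewrite Monoid.iteropE /= => ->; rewrite mulrS.
Qed.

Definition hcomp (d : int) (v : N) : N := projT1 (cid (homdec_ex v)) d.

Lemma hcompE v F : homdec v F -> forall d, hcomp d v = F d.
Proof. by move=> h d; rewrite /hcomp; case: cid => F' /= /(homdec_uniq h) ->. Qed.

Lemma homdec_hcomp v : homdec v (hcomp^~ v).
Proof.
have [F hF] := homdec_ex v; suff -> : hcomp^~ v = F by [].
by apply/funext => d; apply: hcompE.
Qed.

Lemma hcomp_comp d v : comp d (hcomp d v).
Proof. by case: (homdec_hcomp v). Qed.

Lemma hcomp_id d v : comp d v -> forall c, hcomp c v = if c == d then v else 0.
Proof.
move=> hv; apply: hcompE; split=> [c|]; first by case: eqP => [->|_] //; apply: gm_zero.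
exists [:: d]; split=> // [c|]; first by rewrite inE => /negPf ->.
by rewrite big_seq1 eqxx.
Qed.

Lemma hcompD d u v : hcomp d (u + v) = hcomp d u + hcomp d v.
Proof.
apply: (@hcompE _ (fun d => hcomp d u + hcomp d v)); split.
  by move=> c; apply: gm_add; apply: hcomp_comp.
have [s [us e e' out]] := homdec_common (homdec_hcomp u) (homdec_hcomp v).
exists s; split=> // [c /out[-> ->]|]; first by rewrite addr0.
by rewrite big_split -e -e'.
Qed.

Lemma hcomp_act (k : nat) (p : S) v d : p \is k.-homog ->
  hcomp d (p *: v) = p *: hcomp (d - k%:Z) v.
Proof.
move=> hp; apply: (@hcompE _ (fun d => p *: hcomp (d - k%:Z) v)); split.
  by move=> c; rewrite -{1}(subrK k%:Z c); apply: gm_act => //; apply: hcomp_comp.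
have [_ [s [us out e]]] := homdec_hcomp v.
exists [seq c + k%:Z | c <- s]; split.
- by rewrite map_inj_uniq //; apply: addIr.
- move=> c cn; rewrite out ?scaler0 //; apply: contra cn => cs.
  by apply/mapP; exists (c - k%:Z); rewrite ?subrK.
- rewrite {1}e scaler_sumr big_map; apply: eq_bigr => c _.
  by rewrite addrK.
Qed.

Lemma hcomp_sum d (I : Type) (s : seq I) (P : pred I) (F : I -> N) :
  hcomp d (\sum_(i <- s | P i) F i) = \sum_(i <- s | P i) hcomp d (F i).
Proof.
apply: big_morph; first exact: hcompD.
by rewrite (hcomp_id (gm_zero N d)) if_same.
Qed.

Lemma hcompZ d (c : K) v : hcomp d (c%:MP *: v) = c%:MP *: hcomp d v.
Proof.
by rewrite (hcomp_act _ _ (mpolyC_homog c)) subr0.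
Qed.

Lemma hcompB d u v : hcomp d (u - v) = hcomp d u - hcomp d v.
Proof. by rewrite hcompD; have := hcompZ d (-1) v; rewrite mpolyCN !scaleN1r => ->. Qed.

(** Degree d is spanned by the products of a monomial x^m with a component of degree c of a
    generator, where c + deg m = d. Each generator has finitely many components, and deg m = d - c
    leaves finitely many monomials. *)
Lemma fg_is_dim : finitely_generated N -> forall d, exists k, is_dim (comp d) k.
Proof.
case=> g hg d.
have /choice[s hs] : forall v : N, exists s : seq int, v = \sum_(c <- s) hcomp c v.
  by move=> v; have [_ [s [_ _ ?]]] := homdec_hcomp v; exists s.
pose mons (c : int) : seq 'X_{1..r} :=
  [seq m <- [seq (bmnm m) | m <- enum {: 'X_{1..r < `|d - c|%N.+1}}] | c + (mdeg m)%:Z == d].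
pose t := [seq ('X_[m.2] : S) *: hcomp m.1 u | u <- g,
  m <- [seq (c, m) | c <- s u, m <- mons c]].
have tP u c m : u \in g -> c \in s u -> c + (mdeg m)%:Z = d -> 'X_[m] *: hcomp c u \in t.
  move=> ug cs E; apply/allpairsPdep; exists u, (c, m); split=> //.
  apply/allpairsPdep; exists c, m; split=> //.
  rewrite mem_filter E eqxx /=; apply/mapP.
  have mb : (mdeg m < `|d - c|.+1)%N by rewrite -E addrC addKr.
  by exists (BMultinom mb); rewrite ?mem_enum.
apply: (@is_dim_spanned _ _ N (comp d) t); first exact: comp_subspace.
  move=> u /allpairsPdep[w [[c m] [wg /allpairsPdep[c' [m' [cs mm [-> ->]]]] ->]]] /=.
  move: mm; rewrite mem_filter => /andP[/eqP <- _].
  by apply: gm_act; rewrite ?dhomogX //; apply: hcomp_comp.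
move=> v hv W sW tW.
have [c vE] := hg v.
have -> : v = hcomp d v by rewrite (hcomp_id hv) eqxx.
rewrite vE hcomp_sum.
have Wsum (I : eqType) (q : seq I) (F : I -> N) :
    (forall i, i \in q -> W (F i)) -> W (\sum_(i <- q) F i).
  move=> h; rewrite big_seq; apply: (big_ind W) => //; first by case: sW.
  by move=> x y Wx Wy; have := sW.2 1 x y Wx Wy; rewrite scale1r.
have WZ a u : W u -> W (a%:MP *: u).
  by move=> Wu; have := sW.2 a u 0 Wu sW.1; rewrite addr0.
apply: (Wsum) => i _; rewrite (mpolyE (c i)) scaler_suml hcomp_sum; apply: (Wsum) => m _.
rewrite -mul_mpolyC -scalerA hcompZ; apply: (WZ).
have gi : g`_i \in g by apply: mem_nth.
rewrite (hs g`_i) scaler_sumr hcomp_sum; apply: (Wsum) => e es.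
rewrite (hcomp_id (gm_act (_ : 'X_[m] \is (mdeg m).-homog) (hcomp_comp _ _))) ?dhomogX //.
case: eqP => [E|_]; last by case: sW.
by apply: tW; apply: tP => //; rewrite E.
Qed.

End GradedModule.

(** * From regular sequences on a graded module to its Hilbert function *)

Section RegularSequences.
Import mpoly.
Variables (K : fieldType) (r : nat).
Local Notation S := {mpoly K[r]}.

Lemma idealM_rcons (N : lmodType S) (f : seq S) (a : S) (v : N) :
  idealM (rcons f a) v <-> exists w, idealM f (v - a *: w).
Proof.
split=> [[w ->]|[u [w /eqP]]].
  exists (w (size f)), w; rewrite size_rcons big_ord_recr /= nth_rcons ltnn eqxx addrK.
  by apply: eq_bigr => i _; rewrite nth_rcons ltn_ord.
rewrite subr_eq => /eqP ->.
exists (fun i => if (i < size f)%N then w i else u).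
rewrite size_rcons big_ord_recr /= nth_rcons !ltnn eqxx; congr (_ + _).
by apply: eq_bigr => i _; rewrite nth_rcons !ltn_ord.
Qed.

Lemma idealM_nil (N : lmodType S) (v : N) : idealM [::] v <-> v = 0.
Proof. by split=> [[w ->]|->]; [|exists (fun=> 0)]; rewrite big_ord0. Qed.

Lemma foldl_addim_idealM (N : lmodType S) (f : seq S) (v : N) :
  foldl (fun Q g => addim g Q) (fun v : N => v = 0) (scaleops N f) v <-> idealM f v.
Proof.
elim/last_ind: f v => [|f a IH] v; first by rewrite idealM_nil.
rewrite /scaleops map_rcons foldl_rcons idealM_rcons.
by split=> -[w /IH hw]; exists w.
Qed.

Lemma wreg_index (N : lmodType S) (f : seq S) (Q : N -> Prop) : submodP Q ->
  (forall i v, (i < size f)%N ->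
    foldl (fun Q g => addim g Q) Q (scaleops N (take i f)) (f`_i *: v) ->
    foldl (fun Q g => addim g Q) Q (scaleops N (take i f)) v) ->
  wreg Q (scaleops N f).
Proof.
elim: f Q => //= a f IH Q sQ h; split.
  by move=> v; split=> [/(h 0%N v isT)|/(submodPZ sQ)].
apply: IH => [|i v il]; last exact: (h i.+1 v il).
by apply: addim_submod => //; apply: linop_scale.
Qed.

Lemma max_ideal_in_ideal (p : S) : max_ideal p -> in_ideal (fun a : 'I_r => 'X_a) p.
Proof.
case=> w ->; exists (fun a => w a); rewrite size_map size_enum_ord.
apply: eq_bigr => a _; rewrite (nth_map a) ?size_enum_ord // nth_ord_enum.
by rewrite mulrC.
Qed.

(** Bases of the components of N form a model over B = K, from which [wreg_nonneg] starts with no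
    operators. Vanishing in negative degrees allows the model to be indexed by natural numbers. *)
Lemma regular_hilbert (N : gradedModule K r) (f : seq S) (H : nat -> nat) :
  finitely_generated N -> (forall d, hilbert_series N (Posz d) = H d) ->
  (forall d, hilbert_series N (Negz d) = 0%N) ->
  {in f, forall p, max_ideal p} ->
  (forall (i : nat) (v : N), (i < size f)%N ->
     idealM (take i f) (f`_i *: v) -> idealM (take i f) v) ->
  forall d, 0 <= iter (size f) Dop (fun d => (H d)%:Z) d.
Proof.
move=> fgN HN HN0 fm freg d.
have dimN c : is_dim (@gm_comp _ _ N c) (hilbert_series N c).
  by have [k hk] := fg_is_dim fgN c; rewrite /hilbert_series (dimK_eq hk).
have neg0 c v : gm_comp (Negz c) v -> v = 0 :> N.
  move=> hv; have := dimN (Negz c); rewrite HN0 => -[b [_ hb]].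
  by have [c' [-> _]] := hb v hv; rewrite big_ord0.
have dimH c : is_dim (@gm_comp _ _ N (Posz c)) (H c) by rewrite -HN.
pose b c : 'I_(H c) -> N := projT1 (cid (dimH c)).
pose e c (u : 'rV[K]_(H c)) : N := \sum_i (u 0 i)%:MP *: b c i.
have eV c u : gm_comp (Posz c) (e c u).
  have [bV _] := projT2 (cid (dimH c)).
  exact: (subspace_sum _ _ (comp_subspace N c)).
have ex c v : exists u, e c u = hcomp (Posz c) v.
  have [_ hb] := projT2 (cid (dimH c)).
  have [u [vE _]] := hb _ (hcomp_comp (Posz c) v).
  exists (\row_i u i); rewrite /e vE; apply: eq_bigr => i _; by rewrite mxE.
pose pr c v := projT1 (cid (ex c v)).
have e_pr c v : e c (pr c v) = hcomp (Posz c) v := projT2 (cid (ex c v)).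
have e_inj c : injective (e c).
  move=> u u' E; have [_ hb] := projT2 (cid (dimH c)).
  have [w [_ wu]] := hb _ (eV c u).
  have wE (t : 'rV_(H c)) : e c t = e c u -> w = [ffun i => t 0 i].
    move=> tE; apply: wu; rewrite -tE; apply: eq_bigr => i _; by rewrite ffunE.
  have /ffunP := etrans (esym (wE u erefl)) (wE u' (esym E)).
  by move=> h; apply/rowP => i; have := h i; rewrite !ffunE.
have eB c u v : e c (u - v) = e c u - e c v.
  by rewrite -sumrB; apply: eq_bigr => i _; rewrite !mxE mpolyCB scalerBl.
have mod_e : is_model pr e.
  split=> // [c u v|c u]; apply: e_inj; first by rewrite eB !e_pr hcompB.
  by rewrite e_pr (hcomp_id (eV c u)) eqxx.
have [prB _ eK] := mod_e.
have hX1 (a : 'I_r) : ('X_a : S) \is 1.-homog by rewrite dhomogX /= mdeg1.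
have xE (a : 'I_r) c v : hcomp (Posz c.+1) (('X_a : S) *: v) = 'X_a *: hcomp (Posz c) v.
  rewrite (hcomp_act _ _ (hX1 a)).
  by congr (_ *: hcomp _ v); rewrite -addn1 PoszD addrK.
have ls0 : forall i, linop (nth id [::] i : N -> N) by move=> i; rewrite nth_nil.
rewrite -[size f]/(size ([::] : seq (N -> N)) + size f)%N.
apply: (wreg_nonneg (x := fun a : 'I_r => 'X_a : S) (ls := [::]) mod_e _ ls0) => //.
- move=> a; pose X c : 'M[K]_(H c, H c.+1) :=
    \matrix_(i, j) pr c.+1 (('X_a : S) *: b c i) 0 j.
  exists X.
  have eX c (u : 'rV_(H c)) : ('X_a : S) *: e c u = e c.+1 (u *m X c).
    have hX : forall i, e c.+1 (row i (X c)) = ('X_a : S) *: b c i.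
      move=> i; have -> : row i (X c) = pr c.+1 (('X_a : S) *: b c i).
        by apply/rowP => j; rewrite !mxE.
      rewrite e_pr xE (@hcomp_id _ _ _ (Posz c)) ?eqxx //.
      by have [bV _] := projT2 (cid (dimH c)); apply: bV.
    rewrite scaler_sumr /e.
    transitivity (\sum_i (u 0 i)%:MP *: e c.+1 (row i (X c))).
      by apply: eq_bigr => i _; rewrite hX !scalerA mulrC.
    rewrite /e; under eq_bigr do rewrite scaler_sumr.
    rewrite exchange_big; apply: eq_bigr => j _ /=.
    rewrite mxE raddf_sum scaler_suml; apply: eq_bigr => i _.
    by rewrite scalerA -mpolyCM mxE.
  split=> //.
    by move=> c v; apply: e_inj; rewrite e_pr xE -eX e_pr.
  (* The degree 0 part of X_a v is X_a times the part of [v] in degree -1, that is [Negz 0], which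
     is zero. *)
  move=> v; apply: e_inj; rewrite e_pr (model_e0 mod_e).
  rewrite (hcomp_act _ _ (hX1 a)).
  by rewrite (neg0 0%N (hcomp _ _)) ?scaler0 //; apply: hcomp_comp.
- by move=> p /fm; apply: max_ideal_in_ideal.
apply: wreg_index; first by split=> // a u v -> ->; rewrite scaler0 addr0.
by move=> i v il /foldl_addim_idealM h; apply/foldl_addim_idealM; apply: freg.
Qed.

End RegularSequences.

(** * Quotients by monomial ideals *)

Section MonomialIdeals.
Import mpoly.
Variables (K : fieldType) (r : nat).
Local Notation S := {mpoly K[r]}.
Implicit Type us : seq 'X_{1..r}.

Definition mons us : seq S := [seq 'X_[u] | u <- us].

Definition mdiv us (m : 'X_{1..r}) := has (fun u => u <= m)%MM us.

Lemma ideal_submod (s : seq S) (I : eqType) (q : seq I) (F : I -> S) :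
  (forall i, i \in q -> ideal s (F i)) -> ideal s (\sum_(i <- q) F i).
Proof.
move=> h; rewrite big_seq; apply/asboolP.
by apply: (@rpred_sum _ (ideal_zmod s)) => i iq; apply/asboolP/h.
Qed.

Lemma ideal_mulr (s : seq S) (a p : S) : ideal s p -> ideal s (a * p).
Proof. by move=> /asboolP/(ideal_predM a)/asboolP. Qed.

Lemma ideal_mem (s : seq S) (p : S) : p \in s -> ideal s p.
Proof.
move=> /(nthP 0)[i it <-]; exists (fun j : nat => ((j == i)%:R : S)).
rewrite (bigD1 (Ordinal it)) //= eqxx big1 ?addr0 => [|j ji].
  by rewrite -[RHS]/(_ * 1) mulr1.
by rewrite -val_eqE /= in ji; rewrite (negPf ji) -[LHS]/(_ * 0) mulr0.
Qed.

Lemma mons_idealP us (p : S) :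
  ideal (mons us) p <-> {in msupp p, forall m, mdiv us m}.
Proof.
split=> [[w ->] m|h].
  rewrite mcoeff_msupp raddf_sum /= => /eqP ne; apply/negPn/negP => nd; apply: ne.
  apply: big1 => i _; have it : (i < size us)%N by rewrite -(size_map (fun u => 'X_[u] : S)).
  rewrite (nth_map 0%MM) //; apply/memN_msupp_eq0.
  rewrite -[_ *: _]/('X_[nth 0%MM us i] * (w i : S)) mulrC (perm_mem (msuppMX _ _)).
  apply: contra nd => /mapP[m' _ ->]; apply/hasP.
  by exists (nth 0%MM us i); [exact: mem_nth|exact: lem_addr].
rewrite (mpolyE p); apply: ideal_submod => m /h/hasP[u uus um].
rewrite -(submK um) mpolyXD -mul_mpolyC mulrA.
by apply: ideal_mulr; apply: ideal_mem; apply: map_f.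
Qed.

Lemma mons_homog us : {in mons us, forall p : S, p \is homog mdeg}.
Proof. by move=> _ /mapP[u _ ->]; apply/homogP; exists (mdeg u); rewrite dhomogX. Qed.

(** The standard monomials are a basis: by [mons_idealP] two polynomials have the same class exactly
    when their coefficients agree at every monomial outside the ideal. *)
Lemma quot_comp_dim us d (std : seq 'X_{1..r}) : uniq std ->
  (forall m, (m \in std) = (mdeg m == d) && ~~ mdiv us m) ->
  is_dim (@quot_comp K r (mons us) (Posz d)) (size std).
Proof.
move=> ustd hstd; pose b (i : 'I_(size std)) := nth 0%MM std i.
have bin i : b i \in std by apply: mem_nth.
have quotZ (a : S) p : a *: quot_pi (mons us) p = quot_pi (mons us) (a * p).
  exact: quot_scaleE.
exists (fun i => quot_pi (mons us) 'X_[b i]); split.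
  move=> i; exists 'X_[b i] => //; rewrite dhomogX /=.
  by have := bin i; rewrite hstd => /andP[].
have sumE (c : {ffun 'I_(size std) -> K}) :
    \sum_(i < size std) (c i)%:MP *: quot_pi (mons us) 'X_[b i] =
    quot_pi (mons us) (\sum_i c i *: 'X_[b i]).
  by rewrite raddf_sum; apply: eq_bigr => i _; rewrite quotZ mul_mpolyC.
have coefE (c : {ffun 'I_(size std) -> K}) m i : b i = m ->
    (\sum_i c i *: 'X_[b i] : S)@_m = c i.
  move=> <-; rewrite raddf_sum (bigD1 i) //= mcoeffZ mcoeffX eqxx mulr1.
  rewrite big1 ?addr0 // => j ji; rewrite mcoeffZ mcoeffX.
  by rewrite nth_uniq // -[_ == _ :> nat]/(j == i) (negPf ji) mulr0.
move=> v [p hp ->]; exists [ffun i => p@_(b i)]; split.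
  rewrite sumE; apply/quot_piP/mons_idealP => m.
  rewrite mcoeff_msupp => ne; apply/negPn/negP => nd; move/negP: ne; apply.
  rewrite mcoeffB subr_eq0.
  have [ms|ms] := boolP (m \in std).
    have it : (index m std < size std)%N by rewrite index_mem.
    have bm : b (Ordinal it) = m by rewrite /b /= nth_index.
    by rewrite (coefE _ _ _ bm) ffunE bm.
  rewrite (dhomog_nemf_coeff hp); last first.
    by move: ms; rewrite hstd nd andbT.
  rewrite eq_sym; apply/eqP; rewrite raddf_sum big1 // => i _ /=.
  rewrite mcoeffZ mcoeffX; case: eqP => [E|_]; last by rewrite mulr0.
  by move: ms; rewrite -E bin.
move=> c; rewrite sumE => /quot_piP/mons_idealP h; apply/ffunP => i; rewrite ffunE.
apply/eqP; rewrite -subr_eq0; apply/negPn/negP => ne.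
have /h : b i \in msupp (p - \sum_i c i *: 'X_[b i]).
  by rewrite mcoeff_msupp mcoeffB (coefE _ _ i).
by apply/negP; have := bin i; rewrite hstd => /andP[].
Qed.

Lemma quot_comp_dim_neg us d : is_dim (@quot_comp K r (mons us) (Negz d)) 0.
Proof.
exists (fun i => 0); split; first by case.
move=> v /= ->; exists [ffun=> 0]; split; first by rewrite big_ord0.
by move=> c _; apply/ffunP => -[].
Qed.

Lemma quot_fg (s : seq S) : finitely_generated (quot_module s).
Proof.
exists [:: quot_pi s 1] => v; have [p ->] := quot_pi_surj v.
exists (fun=> p); rewrite big_ord1 /=.
by rewrite -[RHS]/(quot_scale _ _) quot_scaleE mulr1.
Qed.

Lemma quot_idealM (s f : seq S) (p : S) :
  idealM f (quot_pi s p : quot_module s) <-> ideal (s ++ f) p.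
Proof.
split=> [[w]|[w ->]].
  have /choice[q hq] : forall i, exists q, w i = quot_pi s q.
    by move=> i; apply: quot_pi_surj.
  have -> : \sum_(i < size f) f`_i *: w i = quot_pi s (\sum_(i < size f) f`_i * q i).
    rewrite raddf_sum; apply: eq_bigr => i _; rewrite hq.
    exact: quot_scaleE.
  move=> /quot_piP[w' E].
  exists (fun i => if (i < size s)%N then w' i else q (i - size s)%N).
  rewrite -[p](subrK (\sum_(i < size f) f`_i * q i)) E size_cat big_split_ord /=.
  congr (_ + _); apply: eq_bigr => i _; rewrite nth_cat.
    by rewrite ltn_ord.
  by rewrite ltnNge leq_addr /= addKn.
exists (fun i => quot_pi s (w (size s + i)%N)).
have -> : \sum_(i < size f) f`_i *: quot_pi s (w (size s + i)%N) =
    quot_pi s (\sum_(i < size f) f`_i * (w (size s + i)%N : S)).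
  by rewrite raddf_sum; apply: eq_bigr => i _; apply: quot_scaleE.
apply/quot_piP; exists w; rewrite size_cat big_split_ord /=.
rewrite -addrA [X in _ + X](_ : _ = 0) ?addr0.
  by apply: eq_bigr => i _; rewrite nth_cat ltn_ord.
apply/eqP; rewrite subr_eq0; apply/eqP; apply: eq_bigr => i _.
by rewrite nth_cat ltnNge leq_addr /= addKn.
Qed.

(** All ideals involved are monomial, so whether x^u is a nonzerodivisor can be tested on single
    exponents. *)
Lemma quot_mons_regular us vs (u : 'X_{1..r}) (v : quot_module (mons us)) :
  (forall m, mdiv (us ++ vs) (m + u)%MM -> mdiv (us ++ vs) m) ->
  idealM (mons vs) (('X_[u] : S) *: v) -> idealM (mons vs) v.
Proof.
move=> h; have [p ->] := quot_pi_surj v.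
rewrite -[_ *: _]/(quot_scale _ _) quot_scaleE => /quot_idealM.
rewrite -map_cat => /mons_idealP hp; apply/quot_idealM.
rewrite -map_cat; apply/mons_idealP => m mp; apply: h; apply: hp.
by rewrite mulrC (perm_mem (msuppMX _ _)) addmC map_f.
Qed.

End MonomialIdeals.

Section MonomialCount.
Import mpoly.
Variables (k n : nat) (f : 'I_k -> 'I_n).
Hypothesis f_inj : injective f.

Definition mpush (m : 'X_{1..k}) : 'X_{1..n} :=
  [multinom (\sum_(i < k | f i == j) m i)%N | j < n].

Lemma mpushE m i : mpush m (f i) = m i.
Proof. by rewrite mnmE (big_pred1 i) // => j; rewrite (inj_eq f_inj). Qed.

Lemma mpush_out m j : (forall i, f i != j) -> mpush m j = 0%N.
Proof. by move=> h; rewrite mnmE big1 // => i /eqP E; have := h i; rewrite E eqxx. Qed.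

Lemma mpush_inj : injective mpush.
Proof. by move=> m m' E; apply/mnmP => i; rewrite -!mpushE E. Qed.

Lemma mdeg_mpush m : mdeg (mpush m) = mdeg m.
Proof.
rewrite !mdegE (partition_big f predT) //=; apply: eq_bigr => j _.
by rewrite mnmE.
Qed.

Definition msub d : seq 'X_{1..n} :=
  [seq mpush m | m <- [seq s2m t | t : d.-tuple 'I_k <- enum (basis k d)]].

Lemma msub_uniq d : uniq (msub d).
Proof. by rewrite map_inj_uniq ?uniq_basis //; apply: mpush_inj. Qed.

Lemma mem_msub d m : (m \in msub d) =
  (mdeg m == d) && [forall j, (m j != 0)%N ==> [exists i, f i == j]].
Proof.
apply/mapP/andP => [[m' hm ->]|[md /forallP h]].
  rewrite mdeg_mpush basis_cover; split=> //; apply/forallP => j; apply/implyP.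
  apply: contraR; rewrite negb_exists => /forallP hj.
  by rewrite mpush_out.
pose m' : 'X_{1..k} := [multinom m (f i) | i < k].
have E : m = mpush m'.
  apply/mnmP => j; have [/existsP[i /eqP <-]|] := boolP [exists i, f i == j].
    by rewrite mpushE mnmE.
  move=> ne; have := h j; rewrite (negPf ne) implybF negbK => /eqP ->.
  by rewrite mpush_out // => i; apply: contra ne => fi; apply/existsP; exists i.
by exists m' => //; rewrite -basis_cover -mdeg_mpush -E.
Qed.

Lemma size_msub d : size (msub d) = 'C((k + d).-1, d).
Proof.
rewrite size_map; case: (k) => [|k']; last by rewrite size_basis addSn addnC.
have e0 (m : 'X_{1..0}) : m = 0%MM by apply/mnmP => -[].
rewrite add0n; case: d => [|d].
  rewrite (perm_size (uniq_perm (uniq_basis 0 0) _ _ : perm_eq _ [:: 0%MM])) //.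
  by move=> m; rewrite -basis_cover inE (e0 m) mdeg0 !eqxx.
rewrite bin_small //; apply/eqP; rewrite -all_pred0; apply/allP => m /=.
by rewrite -basis_cover (e0 m) mdeg0.
Qed.

End MonomialCount.

(** The coefficient of t^d in 1/(1-t)^j. For j = 0 the truncated predecessor gives 1 at d = 0 and 0
    afterwards, which is the series 1. *)
Definition multichoose (j d : nat) : nat := 'C((j + d).-1, d).

Section HilbertXY.
Import mpoly.
Variables (K : fieldType) (n m : nat).

Definition xy_mons : seq 'X_{1..n + m} :=
  [seq (U_(lshift m i) + U_(rshift n j))%MM | i <- enum 'I_n, j <- enum 'I_m].

Lemma xy_gensE : xy_gens K n m = mons K xy_mons.
Proof.
rewrite /mons map_allpairs; apply: eq_allpairs => i j /=.
by rewrite mpolyXD.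
Qed.

Lemma mdiv_xy (u : 'X_{1..n + m}) :
  mdiv xy_mons u = [exists i : 'I_n, [exists j : 'I_m,
    (u (lshift m i) != 0%N) && (u (rshift n j) != 0%N)]].
Proof.
apply/hasP/existsP => [[_ /allpairsP[[i j] [_ _ ->]] /mnm_lepP h]|[i /existsP[j /andP[ui uj]]]].
  exists i; apply/existsP; exists j; rewrite /= in h *.
  have := h (lshift m i); have := h (rshift n j); rewrite !mnmDE !mnm1E !eqxx.
  rewrite addn1 add1n -!lt0n => h1 h2.
  by rewrite (leq_trans (ltn0Sn _) h1) (leq_trans (ltn0Sn _) h2).
exists (U_(lshift m i) + U_(rshift n j))%MM.
  by apply/allpairsP; exists (i, j); rewrite !mem_enum.
apply/mnm_lepP => l; rewrite mnmDE !mnm1E.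
case: eqP => [<-|_]; case: eqP => [E|_] //=; rewrite ?lt0n //.
  by have := congr1 val E; rewrite /= => /eqP; rewrite gtn_eqF // ltn_addr.
by rewrite -E.
Qed.

Lemma mem_msub_l d (u : 'X_{1..n + m}) : (u \in msub (@lshift n m) d) =
  (mdeg u == d) && [forall j : 'I_m, u (rshift n j) == 0%N].
Proof.
rewrite mem_msub; last exact: lshift_inj.
congr (_ && _); apply/forallP/forallP => h j.
  apply: contraT => ne; have := h (rshift n j); rewrite ne /= => /existsP[i].
  by rewrite eq_lrshift.
case: (splitP j) => k E; apply/implyP => ne.
  by apply/existsP; exists k; apply/eqP/val_inj.
by have := h k; rewrite (_ : rshift n k = j) ?(negPf ne) //; apply/val_inj.
Qed.

Lemma mem_msub_r d (u : 'X_{1..n + m}) : (u \in msub (@rshift n m) d) =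
  (mdeg u == d) && [forall i : 'I_n, u (lshift m i) == 0%N].
Proof.
rewrite mem_msub; last exact: rshift_inj.
congr (_ && _); apply/forallP/forallP => h j.
  apply: contraT => ne; have := h (lshift m j); rewrite ne /= => /existsP[i].
  by rewrite eq_rlshift.
case: (splitP j) => k E; apply/implyP => ne; last first.
  by apply/existsP; exists k; apply/eqP/val_inj.
by have := h k; rewrite (_ : lshift m k = j) ?(negPf ne) //; apply/val_inj.
Qed.

(** The monomials outside the ideal involve only x or only y. The monomial 1 is of both kinds,
    whence the exception in degree 0. *)
Definition hilbert_xy (d : nat) : nat :=
  (multichoose n d + (if d == 0%N then 0 else multichoose m d))%N.

Lemma hilbert_xy_pos d : is_dim (@quot_comp K _ (xy_gens K n m) (Posz d)) (hilbert_xy d).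
Proof.
rewrite xy_gensE.
pose std := msub (@lshift n m) d ++ (if d == 0%N then [::] else msub (@rshift n m) d).
have -> : hilbert_xy d = size std.
  by rewrite /hilbert_xy size_cat size_msub; case: eqP => // _; rewrite size_msub.
have nd (u : 'X_{1..n+m}) : ~~ mdiv xy_mons u =
    [forall j : 'I_m, u (rshift n j) == 0%N] || [forall i : 'I_n, u (lshift m i) == 0%N].
  rewrite mdiv_xy; apply/idP/orP.
    move=> h; have [hj|/forallPn[j nj]] := boolP [forall j : 'I_m, u (rshift n j) == 0%N].
      by left.
    right; apply/forallP => i; apply: contraR h => ni.
    by apply/existsP; exists i; apply/existsP; exists j; rewrite ni.
  move=> h; apply/existsP => -[i /existsP[j /andP[ni nj]]].
  by case: h => /forallP h; [move: (h j)|move: (h i)]; apply/negP.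
have both (u : 'X_{1..n+m}) : [forall j : 'I_m, u (rshift n j) == 0%N] ->
    [forall i : 'I_n, u (lshift m i) == 0%N] -> u = 0%MM.
  move=> /forallP h /forallP h'; apply/mnmP => l; rewrite mnm0E.
  case: (splitP l) => k E.
    by rewrite (_ : l = lshift m k) ?(eqP (h' k)) //; apply/val_inj.
  by rewrite (_ : l = rshift n k) ?(eqP (h k)) //; apply/val_inj.
apply: quot_comp_dim.
  rewrite cat_uniq msub_uniq /=; last exact: lshift_inj.
  case: eqP => // /eqP d0; rewrite msub_uniq ?andbT; last exact: rshift_inj.
  apply/hasPn => u; rewrite mem_msub_r mem_msub_l => /andP[/eqP ud ur].
  apply/negP => /andP[_ ul]; move: d0; rewrite -ud (both u) // mdeg0 //.
move=> u; rewrite mem_cat mem_msub_l nd.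
have [d0|_] := eqVneq d 0%N; last by rewrite mem_msub_r -andb_orr.
rewrite in_nil orbF d0 mdeg_eq0; case: (u =P 0%MM) => //= ->.
by rewrite [X in X || _](_ : _ = true) //; apply/forallP => j; rewrite mnm0E.
Qed.

Lemma hilbert_xy_neg d : is_dim (@quot_comp K _ (xy_gens K n m) (Negz d)) 0.
Proof. by rewrite xy_gensE; apply: quot_comp_dim_neg. Qed.

Lemma hilbert_series_xy (d : int) : hilbert_series (graded_quot (@xy_gens_homog K n m)) d =
  if d is Posz d then hilbert_xy d else 0%N.
Proof. by case: d => d; apply: dimK_eq; [apply: hilbert_xy_pos|apply: hilbert_xy_neg]. Qed.

End HilbertXY.

(** * Realizable Hilbert functions *)

(** Multiplication of the generating series by t^e. *)
Definition shiftn (e : nat) (h : nat -> nat) (d : nat) : nat :=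
  if (e <= d)%N then h (d - e)%N else 0%N.

Section Shift.
Import mpoly.
Variables (K : fieldType) (n : nat) (N : gradedModule K n) (e : int).

Definition shift_comp (d : int) := @gm_comp K n N (d - e).

Lemma shift_comp_act (k : nat) d (p : {mpoly K[n]}) v :
  p \is k.-homog -> shift_comp d v -> shift_comp (d + k%:Z) (p *: v).
Proof. by move=> hp hv; rewrite /shift_comp addrAC; apply: gm_act. Qed.

Lemma shift_comp_sum v : exists (F : int -> N) (s : seq int),
  (forall d, shift_comp d (F d)) /\ v = \sum_(d <- s) F d.
Proof.
have [F [s [hF ->]]] := gm_sum v.
exists (fun d => F (d - e)), [seq d + e | d <- s]; split; first by move=> d; apply: hF.
by rewrite big_map; apply: eq_bigr => d _; rewrite addrK.
Qed.

Lemma shift_comp_direct (F : int -> N) (s : seq int) :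
  uniq s -> (forall d, shift_comp d (F d)) -> \sum_(d <- s) F d = 0 ->
  forall d, d \in s -> F d = 0.
Proof.
move=> us hF sF d ds.
have := @gm_direct _ _ N (fun d => F (d + e)) [seq d - e | d <- s].
rewrite map_inj_uniq; last exact: addIr.
move=> /(_ us) H; have -> : F d = F (d - e + e) by rewrite subrK.
apply: H; last by apply/mapP; exists d.
  by move=> c; have := hF (c + e); rewrite /shift_comp addrK.
by rewrite big_map -[RHS]sF; apply: eq_bigr => c _; rewrite subrK.
Qed.

Definition shift_module : gradedModule K n :=
  @GradedModule K n N shift_comp (fun d => gm_zero N (d - e)) (fun d => @gm_add _ _ N (d - e))
    shift_comp_act shift_comp_sum shift_comp_direct.

End Shift.

Section DirectSum.
Import mpoly.
Variables (K : fieldType) (n : nat) (N1 N2 : gradedModule K n).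
Local Notation S := {mpoly K[n]}.
Local Notation N := (N1 * N2)%type.

Definition sum_comp (d : int) : set N :=
  [set v : N | gm_comp d v.1 /\ gm_comp d v.2]%classic.

Lemma sum_comp_zero d : sum_comp d 0.
Proof. by split; apply: gm_zero. Qed.

Lemma sum_compD d u v : sum_comp d u -> sum_comp d v -> sum_comp d (u + v).
Proof. by move=> [u1 u2] [v1 v2]; split; apply: gm_add. Qed.

Lemma sum_comp_act (k : nat) d (p : S) v :
  p \is k.-homog -> sum_comp d v -> sum_comp (d + k%:Z) (p *: v).
Proof. by move=> hp [v1 v2]; split; apply: gm_act. Qed.

Lemma fst_sum (I : Type) (s : seq I) (F : I -> N) :
  (\sum_(d <- s) F d).1 = \sum_(d <- s) (F d).1.
Proof. by apply: (big_morph fst). Qed.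

Lemma snd_sum (I : Type) (s : seq I) (F : I -> N) :
  (\sum_(d <- s) F d).2 = \sum_(d <- s) (F d).2.
Proof. by apply: (big_morph snd). Qed.

Lemma sum_comp_sum v : exists (F : int -> N) (s : seq int),
  (forall d, sum_comp d (F d)) /\ v = \sum_(d <- s) F d.
Proof.
case: v => v1 v2.
have [_ [s1 [_ h1 _]]] := homdec_hcomp v1; have [_ [s2 [_ h2 _]]] := homdec_hcomp v2.
exists (fun d => (hcomp d v1, hcomp d v2)), (undup (s1 ++ s2)); split.
  by move=> d; split; apply: hcomp_comp.
have us := undup_uniq (s1 ++ s2).
rewrite [RHS]surjective_pairing fst_sum snd_sum /=.
congr (_, _); apply: (homdec_widen (homdec_hcomp _)) => // d.
  by rewrite mem_undup mem_cat negb_or => /andP[/h1].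
by rewrite mem_undup mem_cat negb_or => /andP[_ /h2].
Qed.

Lemma sum_comp_direct (F : int -> N) (s : seq int) :
  uniq s -> (forall d, sum_comp d (F d)) -> \sum_(d <- s) F d = 0 ->
  forall d, d \in s -> F d = 0.
Proof.
move=> us hF sF d ds; rewrite [F d]surjective_pairing.
rewrite (@gm_direct _ _ N1 (fun d => (F d).1) s) //; last 2 first.
- by move=> c; case: (hF c).
- by rewrite -fst_sum sF.
rewrite (@gm_direct _ _ N2 (fun d => (F d).2) s) //.
- by move=> c; case: (hF c).
- by rewrite -snd_sum sF.
Qed.

Definition sum_module : gradedModule K n :=
  GradedModule sum_comp_zero sum_compD sum_comp_act sum_comp_sum sum_comp_direct.

Lemma sum_dim (V1 : set N1) (V2 : set N2) k1 k2 : V1 0 -> V2 0 ->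
  is_dim V1 k1 -> is_dim V2 k2 ->
  is_dim ([set v : N | V1 v.1 /\ V2 v.2]%classic : set N) (k1 + k2).
Proof.
move=> V10 V20 [b1 [b1V h1]] [b2 [b2V h2]].
pose b (i : 'I_(k1 + k2)) : N :=
  match fintype.split i with inl j => (b1 j, 0) | inr j => (0, b2 j) end.
exists b; split.
  by move=> i; rewrite /b; case: (fintype.split i) => j; split=> /=.
have sumE (c : {ffun 'I_(k1 + k2) -> K}) : \sum_(i < k1 + k2) (c i)%:MP *: b i =
    (\sum_(i < k1) (c (lshift k2 i))%:MP *: b1 i,
     \sum_(i < k2) (c (rshift k1 i))%:MP *: b2 i).
  rewrite [LHS]surjective_pairing fst_sum snd_sum !big_split_ord /=.
  congr (_, _).
    rewrite [X in _ + X]big1 ?addr0 => [|i _]; last first.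
      by rewrite /b (unsplitK (inr i)) /= scaler0.
    by apply: eq_bigr => i _; rewrite /b (unsplitK (inl i)).
  rewrite big1 ?add0r => [|i _]; last by rewrite /b (unsplitK (inl i)) /= scaler0.
  by apply: eq_bigr => i _; rewrite /b (unsplitK (inr i)).
move=> [v1 v2] [/= /h1[c1 [e1 u1]] /h2[c2 [e2 u2]]].
exists [ffun i => match fintype.split i with inl j => c1 j | inr j => c2 j end]; split.
  rewrite sumE e1 e2; congr (_, _); apply: eq_bigr => i _; rewrite ffunE.
    by rewrite (unsplitK (inl i)).
  by rewrite (unsplitK (inr i)).
move=> c; rewrite sumE => -[/= E1 E2]; apply/ffunP => i; rewrite ffunE.
rewrite -[in RHS](splitK i); case: (fintype.split i) => j /=.
  by rewrite (u1 [ffun i => c (lshift k2 i)]) ?ffunE // E1; apply: eq_bigr => l _; rewrite ffunE.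
by rewrite (u2 [ffun i => c (rshift k1 i)]) ?ffunE // E2; apply: eq_bigr => l _; rewrite ffunE.
Qed.

Lemma sum_fg : finitely_generated N1 -> finitely_generated N2 ->
  finitely_generated (N : lmodType S).
Proof.
case=> g1 h1 [g2 h2]; exists ([seq (u, 0) | u <- g1] ++ [seq (0, u) | u <- g2]) => -[v1 v2].
have [c1 e1] := h1 v1; have [c2 e2] := h2 v2.
exists (fun i => if (i < size g1)%N then c1 i else c2 (i - size g1)%N).
rewrite size_cat !size_map big_split_ord /= [RHS]surjective_pairing /= !fst_sum !snd_sum.
congr (_, _).
  rewrite [X in _ + X]big1 => [|i _].
    rewrite addr0 {1}e1; apply: eq_bigr => i _.
    by rewrite ltn_ord nth_cat size_map ltn_ord (nth_map 0).
  rewrite nth_cat size_map ltnNge leq_addr /= addKn (nth_map 0) //=.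
  by rewrite scaler0.
rewrite [X in X + _]big1 => [|i _].
  rewrite add0r {1}e2; apply: eq_bigr => i _.
  by rewrite nth_cat size_map ltnNge leq_addr /= addKn (nth_map 0).
by rewrite nth_cat size_map ltn_ord (nth_map 0) //= scaler0.
Qed.

Lemma sum_idealM (f : seq S) (v : N) :
  idealM f (v : (N : lmodType S)) <-> idealM f v.1 /\ idealM f v.2.
Proof.
split=> [[w ->]|[[w1 e1] [w2 e2]]].
  split; [exists (fun i => (w i).1)|exists (fun i => (w i).2)].
    by rewrite fst_sum.
  by rewrite snd_sum.
exists (fun i => (w1 i, w2 i)).
by rewrite [LHS]surjective_pairing [RHS]surjective_pairing fst_sum snd_sum e1 e2.
Qed.

End DirectSum.

Section Realizable.
Import mpoly.
Variables (K : fieldType) (n r : nat) (rn : (r <= n)%N).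
Local Notation S := {mpoly K[n]}.

Definition first_mons : seq 'X_{1..n} := [seq U_(widen_ord rn i)%MM | i <- enum 'I_r].
Definition first_vars : seq S := mons K first_mons.

Lemma size_first_mons : size first_mons = r.
Proof. by rewrite size_map size_enum_ord. Qed.

Lemma size_first_vars : size first_vars = r.
Proof. by rewrite size_map size_first_mons. Qed.

(* h is the Hilbert function of a module on which x_1, ..., x_r is regular *)
Definition realizable (h : nat -> nat) : Prop := exists N : gradedModule K n,
  [/\ finitely_generated N,
  (forall d, is_dim (@gm_comp _ _ N (Posz d)) (h d)),
  (forall d, is_dim (@gm_comp _ _ N (Negz d)) 0),
  (forall (i : nat) (v : N), (i < r)%N ->
     idealM (take i first_vars) (first_vars`_i *: v) -> idealM (take i first_vars) v)
  & ((exists d, h d != 0%N) -> exists v : N, ~ idealM first_vars v)].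

Lemma realizable_ext h h' : h =1 h' -> realizable h -> realizable h'.
Proof. by move=> /funext ->. Qed.

Lemma realizable_shift e h : realizable h -> realizable (shiftn e h).
Proof.
case=> N [fg dim dimN reg nz]; exists (shift_module N e); split=> //.
- move=> d; rewrite /shiftn /= /shift_comp; case: leqP => ed; first by rewrite subzn.
  have -> : Posz d - e%:Z = Negz (e - d.+1).
    by rewrite NegzE subnSK // -subzn 1?ltnW // opprB.
  exact: dimN.
- move=> d; rewrite /= /shift_comp.
  have -> : Negz d - e%:Z = Negz (d + e) by rewrite !NegzE -opprD -PoszD addSn.
  exact: dimN.
- case=> d; rewrite /shiftn; case: leqP => // ed h0; apply: nz; by exists (d - e)%N.
Qed.

Lemma realizable_add h1 h2 : realizable h1 -> realizable h2 ->
  realizable (fun d => h1 d + h2 d)%N.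
Proof.
case=> N1 [fg1 dim1 dimN1 reg1 nz1] [N2 [fg2 dim2 dimN2 reg2 nz2]].
exists (sum_module N1 N2); split.
- exact: sum_fg.
- by move=> d; apply: sum_dim => //; apply: gm_zero.
- by move=> d; apply: (sum_dim (k1 := 0) (k2 := 0)) => //; apply: gm_zero.
- move=> i v ir /sum_idealM[i1 i2]; apply/sum_idealM; split.
    exact: reg1 i1.
  exact: reg2 i2.
case=> d; rewrite addn_eq0 negb_and => /orP[] h0.
  have [v hv] := nz1 (ex_intro _ d h0); exists (v, 0).
  by move=> /sum_idealM[/hv].
have [v hv] := nz2 (ex_intro _ d h0); exists (0, v).
by move=> /sum_idealM[_ /hv].
Qed.

Lemma realizable_mons us (std : nat -> seq 'X_{1..n}) :
  (forall d, uniq (std d)) ->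
  (forall d m, (m \in std d) = (mdeg m == d) && ~~ mdiv us m) ->
  (forall (i : 'I_r) m, mdiv (us ++ take i first_mons) (m + U_(widen_ord rn i))%MM ->
     mdiv (us ++ take i first_mons) m) ->
  realizable (fun d => size (std d)).
Proof.
move=> ustd hstd hreg; exists (graded_quot (@mons_homog K n us)); split.
- exact: quot_fg.
- by move=> d; apply: quot_comp_dim.
- by move=> d; apply: quot_comp_dim_neg.
- move=> i v ir.
  have -> : first_vars`_i = 'X_[U_(widen_ord rn (Ordinal ir))] :> S.
    rewrite (nth_map 0%MM) ?size_first_mons // (nth_map (Ordinal ir)) ?size_enum_ord //.
    by have := nth_ord_enum (Ordinal ir) (Ordinal ir); rewrite /= => ->.
  rewrite /first_vars /mons -map_take.
  by apply: quot_mons_regular => m; apply: (hreg (Ordinal ir)).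
case=> d d0; exists (quot_pi (mons K us) 1) => /quot_idealM.
rewrite /first_vars /mons -map_cat => /mons_idealP /(_ 0%MM).
rewrite msupp1 inE eqxx => /(_ isT); rewrite /mdiv has_cat => /orP[|].
  case/hasP => u uus u0; move: d0; case E : (std d) => [|m l] // _.
  have := mem_head m l; rewrite -E hstd => /andP[_ /hasPn/(_ u uus)/negP]; apply.
  by apply/mnm_lepP => i; have /mnm_lepP/(_ i) := u0; rewrite mnm0E leqn0 => /eqP ->.
case/hasP => _ /mapP[i _ ->] /mnm_lepP/(_ (widen_ord rn i)).
by rewrite mnm1E eqxx mnm0E.
Qed.

Lemma realizable0 : realizable (fun=> 0%N).
Proof.
have m0 us (m : 'X_{1..n}) : mdiv (0%MM :: us) m.
  by rewrite /mdiv /= (_ : (0 <= m)%MM) //; apply/mnm_lepP => i; rewrite mnm0E.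
apply: (@realizable_mons [:: 0%MM] (fun=> [::])) => // [d m|i m _].
  by rewrite m0 andbF.
exact: m0.
Qed.

(** The polynomial ring in the first j variables, seen as the quotient of S by the other variables.
    As r <= j, none of x_1, ..., x_r is killed. *)
Lemma realizable_free j : (r <= j <= n)%N -> realizable (multichoose j).
Proof.
case/andP=> rj jn; pose us : seq 'X_{1..n} := 
    [seq U_(i)%MM | i <- [seq i : 'I_n <- enum 'I_n | (j <= i)%N]].
apply: (@realizable_ext (fun d => size (msub (widen_ord jn) d))).
  by move=> d; rewrite size_msub.
have winj : injective (widen_ord jn) by move=> a b /(congr1 val) /= E; apply/val_inj.
apply: (@realizable_mons us).
- by move=> d; apply: msub_uniq.
- move=> d m; rewrite mem_msub //; congr (_ && _).
  apply/forallP/hasPn => [h _ /mapP[i + ->]|h i].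
    rewrite mem_filter => /andP[ji _]; rewrite lep1mP negbK.
    have := h i; case: eqP => //= _ /existsP[l /eqP/(congr1 val) /= E].
    by move: ji; rewrite -E leqNgt ltn_ord.
  apply/implyP => mi; have [ij|ji] := ltnP i j.
    by apply/existsP; exists (Ordinal ij); apply/eqP/val_inj.
  have /h : (U_(i))%MM \in us by apply: map_f; rewrite mem_filter ji mem_enum.
  by rewrite lep1mP mi.
move=> i m /hasP[u uin ud]; apply/hasP; exists u => //.
have [l ul ne] : exists2 l, u = U_(l)%MM & l != widen_ord rn i.
  move: uin; rewrite mem_cat => /orP[/mapP[l + ->]|].
    rewrite mem_filter => /andP[jl _]; exists l => //; apply/eqP => E.
    by move: jl; rewrite E /= leqNgt (leq_trans (ltn_ord i) rj).
  rewrite -map_take => /mapP[l lin ->]; exists (widen_ord rn l) => //.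
  apply/eqP => /(congr1 val) /= E; move: lin; rewrite in_take ?mem_enum //.
  by rewrite index_enum_ord E ltnn.
move: ud; rewrite ul !lep1mP mnmDE mnm1E [_ == l]eq_sym (negPf ne) addn0 //.
Qed.

Lemma realizable_mul k h : realizable h -> realizable (fun d => k * h d)%N.
Proof.
move=> rh; elim: k => [|k IH]; first exact: realizable0.
by apply: realizable_ext (realizable_add rh IH) => d; rewrite mulSn.
Qed.

Lemma realizable_sum (I : Type) (s : seq I) (p : pred I) (h : I -> nat -> nat) :
  all p s -> (forall i, p i -> realizable (h i)) ->
  realizable (fun d => \sum_(i <- s) h i d)%N.
Proof.
move=> ps rh; elim: s ps => [_|i s IH /andP[pi ps]].
  by apply: realizable_ext realizable0 => d; rewrite big_nil.
by apply: realizable_ext (realizable_add (rh i pi) (IH ps)) => d; rewrite big_cons.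
Qed.

End Realizable.

(** * Nonnegative decompositions of the Hilbert series *)

Section Decomposition.

Lemma multichooseS j d :
  multichoose j.+1 d.+1 = (multichoose j d.+1 + multichoose j.+1 d)%N.
Proof. by rewrite /multichoose !addSn !addnS /= binS. Qed.

Lemma multichoosen0 j : multichoose j 0 = 1%N. Proof. exact: bin0. Qed.

Lemma multichoose0n d : multichoose 0 d = (d == 0%N).
Proof. by case: d => [|d] //; rewrite /multichoose add0n bin_small. Qed.

(** From 1/(1-t) = 1 + t/(1-t), multiplied by t^e/(1-t)^j. *)
Lemma shiftn_multichooseS e j d : shiftn e (multichoose j.+1) d =
  (shiftn e (multichoose j) d + shiftn e.+1 (multichoose j.+1) d)%N.
Proof.
rewrite /shiftn; case: (ltngtP e d) => [ed|de|->]; last 2 first.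
- by rewrite addn0.
- by rewrite subnn !multichoosen0.
by rewrite -(subnSK ed) multichooseS.
Qed.

(* the expansion of 1/(1-t)^(r+a) along the powers t^i/(1-t)^r, i < D *)
Lemma multichoose_expand r a D : exists2 L : seq (nat * nat),
  all (fun x => r <= x.1 <= r + a)%N L &
  forall d, multichoose (r + a) d =
    (\sum_(i < D) multichoose a i * shiftn i (multichoose r) d
     + \sum_(x <- L) shiftn x.2 (multichoose x.1) d)%N.
Proof.
elim: a D => [|a IHa] D.
  case: D => [|D].
    exists [:: (r, 0)] => /= [|d]; first by rewrite addn0 leqnn.
    by rewrite big_ord0 big_seq1 /shiftn subn0 addn0.
  exists [::] => // d; rewrite big_nil addn0 big_ord_recl big1 => [|i _].
    by rewrite multichoosen0 mul1n !addn0 /shiftn subn0.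
  by rewrite multichoose0n.
(* 1/(1-t)^(r+a+1) is 1/(1-t)^(r+a), expanded to D + 1 terms, plus t times itself, expanded to D
   terms and shifted by one. The coefficients add up by [multichooseS]. *)
elim: D => [|D [L2 hL2 E2]].
  exists [:: (r + a.+1, 0)%N] => /= [|d]; first by rewrite leqnn leq_addr.
  by rewrite big_ord0 big_seq1 /shiftn subn0.
have [L1 hL1 E1] := IHa D.+1.
exists (L1 ++ [seq (x.1, x.2.+1) | x <- L2]).
  rewrite all_cat all_map /= hL2 andbT; apply: sub_all hL1 => x /andP[-> h] /=.
  by apply: leq_trans h _; rewrite leq_add2l.
move=> d; have := shiftn_multichooseS 0 (r + a) d.
rewrite {1 2}/shiftn !subn0 /= addnS => ->; rewrite E1 big_cat big_map /=.
have -> : shiftn 1 (multichoose (r + a).+1) d =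
    (\sum_(i < D) multichoose a.+1 i * shiftn i.+1 (multichoose r) d
     + \sum_(x <- L2) shiftn x.2.+1 (multichoose x.1) d)%N.
  case: d => [|d]; first by rewrite /shiftn /= !big1 // => i _; rewrite muln0.
  rewrite -addnS {1}/shiftn subn1 /= E2 //.
rewrite addnACA; congr (_ + _)%N; rewrite !big_ord_recl -addnA; congr (_ + _)%N.
  by rewrite !multichoosen0.
rewrite -big_split; apply: eq_bigr => i _ /=.
by rewrite -mulnDl multichooseS.
Qed.

(** Binomial expansion of the numerator in t^e/(1-t)^j = t^e (1-t)^s/(1-t)^(j+s); any D > s covers
    all of its terms. *)
Lemma multichoose_alternate D s e j d : (s < D)%N ->
  (shiftn e (multichoose j) d)%:Z =
  \sum_(i < D) (-1) ^+ i * 'C(s, i)%:Z * (shiftn (e + i) (multichoose (j + s)) d)%:Z.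
Proof.
elim: s D e j => [|s IH] [|D] e j //= sD.
  rewrite big_ord_recl big1 => [|i _]; last by rewrite bin0n mulr0 mul0r.
  by rewrite bin0 !mul1r !addn0 addr0.
have /(congr1 Posz) := shiftn_multichooseS e j d; rewrite PoszD => /(canLR (addrK _)) <-.
rewrite (IH D.+1) ?(ltnW sD) // (IH D) // !big_ord_recl /= -addrA addSnnS; congr (_ + _).
  by rewrite !bin0.
rewrite -sumrB; apply: eq_bigr => i _.
rewrite /bump /= add1n binS PoszD addnS exprS mulN1r -mulrBl; congr (_ * _).
by rewrite mulrDr !mulNr.
Qed.

Lemma bin_le_multichoose r a i : (r <= a)%N -> (0 < i)%N -> ('C(r, i) <= multichoose a i)%N.
Proof.
by move=> ra i0; apply: leq_bin2l; case: i i0 => // i _; rewrite addnS /= (leq_trans ra) ?leq_addr.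
Qed.

Lemma hilbert_xyE n m d : (hilbert_xy n m d)%:Z =
  (multichoose n d)%:Z + (multichoose m d)%:Z - (multichoose 0 d)%:Z.
Proof.
rewrite /hilbert_xy multichoose0n PoszD; case: eqP => [->|_]; last by rewrite subr0.
by rewrite !multichoosen0.
Qed.

(** The negative term -1 is -(1-t)^r/(1-t)^r, with a numerator of degree r. Expanding 1/(1-t)^n to D
    = r + 1 terms therefore reaches every power of t where compensation is due, and what remains of
    it is already a sum of admissible series. *)
Lemma realizable_hilbert_xy (K : fieldType) n m r (rn : (r <= n + m)%N) :
  (r.*2 <= n)%N -> (m <= n)%N -> realizable K rn (hilbert_xy n m).
Proof.
move=> r2n mn; pose D := r.+1.
have rln : (r <= n)%N by apply: leq_trans r2n; rewrite -addnn leq_addr.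
have ra : (r <= n - r)%N by rewrite leq_subRL // addnn.
have [L1 hL1 E1] := multichoose_expand r (n - r) D; rewrite subnKC // in hL1 E1.
have sh0 (h : nat -> nat) d : h d = shiftn 0 h d by rewrite /shiftn subn0.
suff [w [L [hL E]]] : exists (w : nat -> nat) (L : seq (nat * nat)),
    all (fun x => r <= x.1 <= n)%N L /\ forall d, hilbert_xy n m d =
    (\sum_(i < D) w i * shiftn i (multichoose r) d
     + \sum_(x <- L) shiftn x.2 (multichoose x.1) d)%N.
  apply: (realizable_ext (fun d => esym (E d))); apply: realizable_add.
    apply: (realizable_sum (p := predT)) => [|i _]; first exact: all_predT.
    apply/realizable_mul/realizable_shift/realizable_free.
    by rewrite leqnn.
  apply: (realizable_sum hL) => x /andP[rx xn]; apply/realizable_shift/realizable_free.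
  by rewrite rx (leq_trans xn) ?leq_addr.
have E0 d : (multichoose 0 d)%:Z =
    \sum_(i < D) (-1) ^+ i * 'C(r, i)%:Z * (shiftn i (multichoose r) d)%:Z.
  by rewrite sh0 (@multichoose_alternate D r).
(* Both parities of i work because c_(n-r)(i) >= 'C(r, i) as r <= n - r. *)
have [w2 [L2 [hL2 E2 w20]]] : exists (w2 : nat -> int) (L2 : seq (nat * nat)),
    [/\ all (fun x => r <= x.1 <= n)%N L2, forall d, (multichoose m d)%:Z =
      \sum_(i < D) w2 i * (shiftn i (multichoose r) d)%:Z
       + (\sum_(x <- L2) shiftn x.2 (multichoose x.1) d)%N%:Z
    & forall i, 0 <= (multichoose (n - r) i)%:Z + w2 i - (-1) ^+ i * 'C(r, i)%:Z].
  have [rm|mr] := leqP r m.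
    have [L2 hL2 E2] := multichoose_expand r (m - r) D; rewrite subnKC // in hL2 E2.
    exists (fun i => (multichoose (m - r) i)%:Z), L2; split.
    - by apply: sub_all hL2 => x /andP[-> /leq_trans ->].
    - move=> d; rewrite E2 PoszD; congr (_ + _).
      by rewrite (big_morph Posz PoszD (erefl _)).
    - move=> i; case: i => [|i]; first by rewrite !multichoosen0 bin0 mul1r.
      rewrite subr_ge0; apply: (@le_trans _ _ 'C(r, i.+1)%:Z).
        by rewrite -signr_odd; case: odd; rewrite ?mul1r // mulN1r ge0_cp.
      by rewrite -PoszD lez_nat (leq_trans (bin_le_multichoose ra _)) ?leq_addr.
  (* For m < r the second series is (1-t)^(r-m)/(1-t)^r and alternates too. Its negative terms, at
     odd i, are outweighed by the contribution +'C(r, i) of the term -1. *)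
  exists (fun i => (-1) ^+ i * 'C(r - m, i)%:Z), [::]; split=> //.
  - move=> d; rewrite big_nil addr0 sh0 (@multichoose_alternate D (r - m)) ?subnKC // ?(ltnW mr) //.
    by rewrite ltnS leq_subr.
  - move=> i; case: i => [|i]; first by rewrite !multichoosen0 !bin0 mul1r.
    have h1 := bin_le_multichoose ra (ltn0Sn i).
    have h2 : ('C(r - m, i.+1) <= 'C(r, i.+1))%N by apply: leq_bin2l; apply: leq_subr.
    rewrite -signr_odd; case: odd; rewrite ?mul1r ?mulN1r ?opprK.
      by rewrite -addrA addr_ge0 // addrC subr_ge0 lez_nat.
    rewrite addrAC addr_ge0 // subr_ge0 lez_nat //.
exists (fun i => absz ((multichoose (n - r) i)%:Z + w2 i - (-1) ^+ i * 'C(r, i)%:Z)%R).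
exists (L1 ++ L2); split; first by rewrite all_cat hL1.
have sumZ (F : 'I_D -> nat) : (\sum_(i < D) F i)%N%:Z = \sum_(i < D) (F i)%:Z.
  exact: (big_morph Posz PoszD).
move=> d; apply/eqP; rewrite -eqz_nat hilbert_xyE E1 E2 E0 big_cat /= !PoszD !sumZ.
apply/eqP; under [X in _ = X + _]eq_bigr do rewrite PoszM gez0_abs // mulrBl mulrDl.
by rewrite sumrB big_split /= addrACA [LHS]addrAC.
Qed.

End Decomposition.

(** * Bounds on the Hilbert depth *)

Lemma Dop0 g : Dop g 0 = g 0%N. Proof. exact: subr0. Qed.
Lemma DopS g d : Dop g d.+1 = g d.+1 - g d. Proof. by []. Qed.

Lemma Dop_linear k f g h d :
  iter k Dop (fun d => f d + g d - h d) d =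
  iter k Dop f d + iter k Dop g d - iter k Dop h d.
Proof.
by elim: k d => //= k IH [|d]; rewrite ?Dop0 ?DopS !IH //; lia.
Qed.

Lemma Dop_multichoose k j d :
  iter k Dop (fun d => (multichoose (j + k) d)%:Z) d = (multichoose j d)%:Z.
Proof.
elim: k j d => [|k IH] j d; first by rewrite addn0.
rewrite iterSr -[RHS]IH; apply: Dop_ext => -[|d']; rewrite /Dop addnS.
  by rewrite !multichoosen0 subr0.
by rewrite multichooseS PoszD addrK.
Qed.

(** These are the coefficients of (1-t)^k, as [multichoose 0] is the series 1. *)
Lemma Dop_multichoose0 k d :
  iter k Dop (fun d => (multichoose 0 d)%:Z) d = (-1) ^+ d * 'C(k, d)%:Z.
Proof.
elim: k d => [|k IH] d /=.
  by rewrite multichoose0n; case: d => [|d] //; rewrite mulr0.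
case: d => [|d]; first by rewrite Dop0 IH !bin0.
by rewrite DopS !IH binS PoszD exprS !mulN1r mulrDr !mulNr.
Qed.

(** Pascal's rule s times; every increment is at least 'C(M, p). *)
Lemma bin_lower M s p : ('C(M, p.+1) + s * 'C(M, p) <= 'C(M + s, p.+1))%N.
Proof.
elim: s => [|s IH]; first by rewrite !addn0.
rewrite addnS binS mulSn addnA addnAC leq_add //.
by apply: leq_bin2l; apply: leq_addr.
Qed.

(** Put M = a + p + 1 and y = 'C(M, p+1). The left side is 'C(M, p+2) = y a/(p+2), and 'C(M, p) = y
    (p+1)/(a+1), so by [bin_lower] the right side is at least y (1 + s (p+1)/(a+1)). The hypothesis
    says a/(p+2) <= s (p+1)/(a+1). *)
Lemma multichoose_lt_bin a p s : (a * a.+1 <= s * (p.+1 * p.+2))%N ->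
  (multichoose a p.+2 < 'C(a + p.+1 + s, p.+1))%N.
Proof.
move=> as_; rewrite /multichoose addnS /=; set M := (a + p.+1)%N.
have e1 := mul_bin_left M p.+1; have e2 := mul_bin_left M p.
have MA : (M - p.+1 = a)%N by rewrite /M addnK.
have MB : (M - p = a.+1)%N by rewrite /M addnS -addSn addnK.
rewrite {}MA in e1; rewrite {}MB in e2.
have h := bin_lower M s p.
have c0 : (0 < 'C(M, p.+1))%N by rewrite bin_gt0 leq_addl.
move: e1 e2 h c0; set x := 'C(M, p.+2); set y := 'C(M, p.+1); set z := 'C(M, p).
set t := 'C(_, _) => e1 e2 h c0.
rewrite ltnNge; apply/negP => tx.
have : (p.+2 * a.+1 * (y + s * z) <= p.+2 * a.+1 * x)%N.
  by rewrite leq_mul2l (leq_trans h tx) orbT.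
rewrite mulnDr leqNgt => /negP; apply.
have -> : (p.+2 * a.+1 * x = a * a.+1 * y)%N by rewrite mulnAC e1; lia.
have -> : (p.+2 * a.+1 * (s * z) = s * (p.+1 * p.+2) * y)%N.
  have -> : (p.+2 * a.+1 * (s * z) = p.+2 * s * (a.+1 * z))%N by lia.
  by rewrite -e2; lia.
apply: (leq_ltn_trans (leq_mul as_ (leqnn y))).
by rewrite -[X in (X < _)%N]add0n ltn_add2r !muln_gt0 c0.
Qed.

(** With k = a + p + 2 + s and d = p + 2 even, the coefficient of t^d is [multichoose a d] plus a
    term from m, minus 'C(k, d). Pascal's rule splits 'C(k, d) into 'C(k-1, d-1), which exceeds the
    first term, and 'C(k-1, d), which bounds the term from m: for m < k that term is 'C(k-m, d), and
    m >= 1. *)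
Lemma Dop_hilbert_xy_lt0 n m a p s : (1 <= m <= n)%N -> ~~ odd p ->
  n = (a + (a + p.+2 + s))%N -> (a * a.+1 <= s * (p.+1 * p.+2))%N ->
  (p.+2.*2 <= a + p.+2 + s)%N ->
  iter (a + p.+2 + s) Dop (fun d => (hilbert_xy n m d)%:Z) p.+2 < 0.
Proof.
case/andP=> m0 mn pe nE as_ pk; set k := (a + p.+2 + s)%N in nE pk *.
rewrite (Dop_ext _ (hilbert_xyE n m)) Dop_linear Dop_multichoose0 nE Dop_multichoose.
have -> : (-1) ^+ p.+2 = 1 :> int by rewrite -signr_odd /= negbK (negPf pe).
rewrite mul1r subr_lt0.
have lt1 := multichoose_lt_bin as_.
have kE : k = (a + p.+1 + s).+1 by rewrite /k; lia.
have binE : 'C(k, p.+2) = ('C(a + p.+1 + s, p.+2) + 'C(a + p.+1 + s, p.+1))%N by rewrite kE binS.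
have [km|mk] := leqP k m.
  have -> : iter k Dop (fun d => (multichoose m d)%:Z) p.+2 = (multichoose (m - k) p.+2)%:Z.
    by rewrite -[RHS](Dop_multichoose k) subnK.
  rewrite -PoszD ltz_nat binE.
  have le1 : (multichoose (m - k) p.+2 <= multichoose a p.+2)%N.
    by apply: leq_bin2l; lia.
  (* Binomials increase up to the middle, and 2 (p + 2) <= k places p + 2 below it. *)
  have le2 : ('C(a + p.+1 + s, p.+1) <= 'C(a + p.+1 + s, p.+2))%N.
    have := mul_bin_left (a + p.+1 + s) p.+1; set u := 'C(_, p.+2); set v := 'C(_, p.+1) => E.
    have : (p.+2 * v <= p.+2 * u)%N by rewrite E leq_mul2r; apply/orP; right; lia.
    by rewrite leq_mul2l.
  by rewrite addnC; apply: leq_ltn_trans (leq_add le1 (leqnn _)) _; lia.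
have -> : iter k Dop (fun d => (multichoose m d)%:Z) p.+2 = 'C(k - m, p.+2)%:Z.
  rewrite -{1}(subnK (ltnW mk)) iterD.
  rewrite (@Dop_ext _ _ (fun d => (multichoose 0 d)%:Z)); last first.
    by move=> d; rewrite -[RHS](Dop_multichoose m) add0n.
  by rewrite Dop_multichoose0 -signr_odd /= negbK (negPf pe) mul1r.
rewrite -PoszD ltz_nat binE addnC.
have le1 : ('C(k - m, p.+2) <= 'C(a + p.+1 + s, p.+2))%N by apply: leq_bin2l; lia.
by rewrite -addnS leq_add.
Qed.

Section Suprema.

Lemma supremum_le (A : set nat) b : (forall k, A k -> (k <= b)%N) ->
  (supremum 0%N A <= b)%N.
Proof.
move=> hb; rewrite /supremum; case: ifP => // _; case: xgetP => // x _ [_ lb].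
by apply: lb => k /hb; rewrite leEnat.
Qed.

(** The bound guarantees that a supremum exists in nat; for an unbounded set the value would be the
    default 0. *)
Lemma supremum_ge (A : set nat) b k : (forall k, A k -> (k <= b)%N) -> A k ->
  (k <= supremum 0%N A)%N.
Proof.
move=> hb Ak; rewrite /supremum; case: ifP => [/eqP A0|_]; first by rewrite A0 in Ak.
have ex : exists i, `[< A i >] by exists k; apply/asboolP.
have ub i : `[< A i >] -> (i <= b)%N by move=> /asboolP/hb.
case: (ex_maxnP ex ub) => x /asboolP Ax xmax.
have xs : supremums A x.
  split; first by move=> i Ai; rewrite leEnat; apply: xmax; apply/asboolP.
  by move=> y; apply.
case: xgetP => [y _ [yub _]|/(_ x)//].
by have := yub _ Ak; rewrite leEnat.
Qed.

End Suprema.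

Section HilbertDepth.
Import mpoly.
Variables (K : fieldType) (n m : nat).
Local Notation S := {mpoly K[n + m]}.
Local Notation hs := (hilbert_series (graded_quot (@xy_gens_homog K n m))).

(** A longer sequence is cut to its first k = a + p + 2 + s elements, since the nonzerodivisor
    conditions pass to initial segments; k elements already contradict the negative coefficient. *)
Lemma regular_size_lt (N : gradedModule K (n + m)) (f : seq S) a p s :
  finitely_generated N -> hilbert_series N = hs ->
  {in f, forall q, max_ideal q} -> regular_seq N f ->
  (1 <= m <= n)%N -> ~~ odd p ->
  n = (a + (a + p.+2 + s))%N -> (a * a.+1 <= s * (p.+1 * p.+2))%N ->
  (p.+2.*2 <= a + p.+2 + s)%N -> (size f < a + p.+2 + s)%N.
Proof.
move=> fg hN fm [freg _] mn pe nE as_ pk; rewrite ltnNge; apply/negP => le.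
set k := (a + p.+2 + s)%N in le.
have sz : size (take k f) = k by rewrite size_take; case: ltngtP le.
have := Dop_hilbert_xy_lt0 mn pe nE as_ pk; rewrite -/k -sz ltNge => /negP; apply.
apply: (regular_hilbert fg (f := take k f)).
- by move=> d; rewrite hN hilbert_series_xy.
- by move=> d; rewrite hN hilbert_series_xy.
- by move=> q /mem_take; apply: fm.
move=> i v; rewrite sz => ik; rewrite take_takel ?(ltnW ik) // nth_take //.
by apply: freg; apply: leq_trans le.
Qed.

(** The upper bound serves the lower bound as well: both [depth] and [hdepth] are suprema, and
    exhibiting a member bounds them from below only once their sets are known to be bounded. *)
Lemma hdepth_xy_bounds a p s r : (1 <= m <= n)%N -> ~~ odd p ->
  n = (a + (a + p.+2 + s))%N -> (a * a.+1 <= s * (p.+1 * p.+2))%N ->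
  (p.+2.*2 <= a + p.+2 + s)%N -> (r.*2 <= n)%N ->
  (r <= hdepth_xy K n m < a + p.+2 + s)%N.
Proof.
move=> mn pe nE as_ pk rn; set k := (a + p.+2 + s)%N in as_ pk *.
have depth_set (N : gradedModule K (n + m)) : finitely_generated N ->
    hilbert_series N = hs -> forall l, (exists f : seq S,
    [/\ size f = l, {in f, forall p, max_ideal p} & regular_seq N f]) -> (l <= k.-1)%N.
  move=> fg hN l [f [<- fm freg]].
  have := regular_size_lt fg hN fm freg mn pe nE as_ pk.
  by rewrite -/k; case: (k).
have hdepth_set l : (exists N : gradedModule K (n + m),
    [/\ finitely_generated N, hilbert_series N = hs & depth N = l]) -> (l <= k.-1)%N.
  by case=> N [fg hN <-]; apply: supremum_le; apply: depth_set.
apply/andP; split; last first.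
  have : (hdepth_xy K n m <= k.-1)%N by apply: supremum_le => l; apply: hdepth_set.
  by rewrite /k addnS addSn.
have rn' : (r <= n + m)%N by lia.
have [N [fg dim dimN reg nz]] := realizable_hilbert_xy K rn' rn (andP mn).2.
have hN : hilbert_series N = hs.
  apply/funext => d; rewrite hilbert_series_xy.
  by case: d => d; apply: dimK_eq.
have rd : (r <= depth N)%N.
  apply: (supremum_ge (depth_set N fg hN)).
  exists (first_vars K rn'); split; first exact: size_first_vars.
    move=> q /mapP[u /mapP[i _ ->] ->]; apply: ideal_mem.
    by apply/mapP; exists (widen_ord rn' i); rewrite ?mem_enum.
  split; first by move=> i v; rewrite size_first_vars; apply: reg.
  apply: nz; exists 0%N; by rewrite /hilbert_xy multichoosen0.
apply: (leq_trans rd); apply: (supremum_ge hdepth_set).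
by exists N.
Qed.

End HilbertDepth.

(** * Choice of the parameters and passage to the limit *)

Lemma exp4_bracket W n : (W ^ 4 <= n)%N ->
  exists w, (W <= w)%N /\ (w ^ 4 <= n < w.+1 ^ 4)%N.
Proof.
move=> Wn; have ex : exists w, (w ^ 4 <= n)%N by exists W.
have ub w : (w ^ 4 <= n)%N -> (w <= n)%N by apply: leq_trans; case: w => // w; apply: (@leq_pexp2l w.+1 1 4).
case: (ex_maxnP ex ub) => w wn wmax; exists w; split; first exact: wmax.
by rewrite wn ltnNge; apply/negP => /wmax; rewrite ltnn.
Qed.

(* the parameters of hdepth_xy_bounds are p + 2 = 2 w^3 and s ~ w^2, where w ~ n^(1/4) *)
Lemma hdepth_xy_asymptotic (K : fieldType) n m W : (9 <= W)%N -> (W ^ 4 <= n)%N ->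
  (1 <= m <= n)%N ->
  (n <= (hdepth_xy K n m).*2.+1)%N /\ ((hdepth_xy K n m).*2 * W <= n * W + 3 * n)%N.
Proof.
move=> W9 /exp4_bracket[w [Ww /andP[wn nw]]] mn.
have w9 := leq_trans W9 Ww.
have w4 : (w.+1 ^ 4 <= 2 * w ^ 4)%N.
  (* Here the constant 9 originates: it is the least positive w satisfying this inequality, whose
     square gives (w+1)^4 <= 25/16 w^4. *)
  have h : (4 * w.+1 ^ 2 <= 5 * w ^ 2)%N by nia.
  have e4 v : (v ^ 4 = v ^ 2 * v ^ 2)%N by rewrite -expnD.
  by have := leq_mul h h; rewrite !e4; lia.
have x32 : (9 * w ^ 2 <= w ^ 3)%N by rewrite (expnS w 2) leq_mul2r w9 orbT.
have x43 : (9 * w ^ 3 <= w ^ 4)%N by rewrite (expnS w 3) leq_mul2r w9 orbT.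
have x2 : (81 <= w ^ 2)%N by rewrite (leq_sqr 9).
have x8 : (w ^ 4 * w ^ 4 = w ^ 2 * (w ^ 3 * w ^ 3))%N by rewrite -!expnD.
have x4W : (w ^ 3 * W <= w ^ 4)%N by rewrite (expnSr w 3) leq_mul2l Ww orbT.
move: w4 x32 x43 x2 x8 x4W wn nw.
set x := (w ^ 2)%N; set y := (w ^ 3)%N; set z := (w ^ 4)%N; set z' := (w.+1 ^ 4)%N.
move=> w4 x32 x43 x2 x8 x4W wn nw.
(* As p + 2 = 2 w^3 is even, n = 2 a + (p + 2) + s forces s to have the parity of n; [b] corrects
   w^2 accordingly. *)
pose b : nat := odd (n - x); pose s := (x + b)%N; pose p := (2 * y - 2)%N.
pose a := ((n - x - b)./2 - y)%N.
have b1 : (b <= 1)%N by rewrite /b; case: odd.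
have ev : ((n - x - b)./2 * 2 = n - x - b)%N.
  by rewrite muln2 -[RHS]odd_double_half oddB ?[odd b]oddb ?addbb //; rewrite /b; lia.
have p2 : p.+2 = (2 * y)%N by rewrite /p; lia.
have nE : n = (a + (a + p.+2 + s))%N by rewrite p2 /a /s; lia.
have as_ : (a * a.+1 <= s * (p.+1 * p.+2))%N.
  (* n < 2 w^4 gives a + 1 <= w^4, and w^8 = w^2 w^3 w^3 with w^2 <= s and w^3 <= p + 1. *)
  have az : (a.+1 <= z)%N by lia.
  apply: (leq_trans (leq_mul (ltnW az) az)); rewrite x8; apply: leq_mul.
    exact: leq_addr.
  by apply: leq_mul; lia.
have pe : ~~ odd p by rewrite -[odd p]negbK -[~~ odd p]/(odd p.+1) -[~~ odd _]/(odd p.+2) p2 oddM.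
have pk : (p.+2.*2 <= a + p.+2 + s)%N by rewrite -muln2 p2; lia.
have rn : (n./2.*2 <= n)%N by rewrite -{2}(odd_double_half n) leq_addl.
have /andP[lo hi] := hdepth_xy_bounds K mn pe nE as_ pk rn.
have {}lo : (n <= (hdepth_xy K n m).*2.+1)%N.
  by have := odd_double_half n; have := leq_b1 (odd n); lia.
split => //.
(* The double of a + p + 2 + s is n + 2 w^3 + s, and s <= w^2 + 1 <= w^3. The factor W then turns
   w^3 into at most w^4 <= n. *)
have h3 : ((hdepth_xy K n m).*2 <= n + 3 * y)%N by rewrite /s in nE; lia.
apply: (leq_trans (leq_mul h3 (leqnn W))).
by rewrite mulnDl leq_add2l -mulnA leq_mul2l /= (leq_trans x4W wn).
Qed.

From mathcomp Require Import lra all_classical all_reals all_analysis.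
Import numFieldNormedType.Exports.
Local Open Scope classical_set_scope.
Local Open Scope ring_scope.

Theorem corollary3p4 (R : realType) (K : fieldType) (m : nat -> nat)
    (hm : forall n : nat, (1 <= n)%N -> (1 <= m n <= n)%N) :
  ((hdepth_xy K n (m n))%:R / n%:R : R) @[n --> \oo] --> (1 / 2%:R : R).
Proof.
apply/cvgrPdist_lt => eps eps0.
(* The upper estimate reads h/n <= 1/2 + 3/(2 W) and the lower one h/n >= 1/2 - 1/(2 n) with n >= W,
   so W > 3/eps keeps both errors below eps. *)
pose W := (Num.bound (3 / eps) + 9)%N.
have W9 : (9 <= W)%N by apply: leq_addl.
have W0 : (0 < W)%N by apply: leq_trans W9.
have Weps : 3 < eps * W%:R.
  rewrite mulrC -ltr_pdivrMr //; apply: lt_le_trans (archi_boundP _) _.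
    by rewrite divr_ge0 // ltW.
  by rewrite ler_nat leq_addr.
near=> n.
have Wn : (W ^ 4 <= n)%N by near: n; apply: nbhs_infty_ge.
have n0 : (0 < n)%N by apply: leq_trans Wn; rewrite expn_gt0 W0.
have [lo hi] := hdepth_xy_asymptotic K W9 Wn (hm n n0).
set h := hdepth_xy K n (m n) in lo hi *.
have nR : 0 < n%:R :> R by rewrite ltr0n.
have WR : 0 < W%:R :> R by rewrite ltr0n.
have Wn' : W%:R <= n%:R :> R.
  by rewrite ler_nat; apply: leq_trans Wn; rewrite -{1}[W]expn1 leq_pexp2l.
have {}lo : n%:R <= 2 * h%:R + 1 :> R by rewrite -natrM natr1 ler_nat mul2n.
have {}hi : 2 * h%:R * W%:R <= n%:R * W%:R + 3 * n%:R :> R.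
  by rewrite -!natrM -natrD ler_nat mul2n.
have hE : h%:R = h%:R / n%:R * n%:R :> R by rewrite divfK // gt_eqF.
set q : R := h%:R / n%:R in hE *.
rewrite hE in lo hi.
rewrite ltr_norml; apply/andP; split.
  rewrite ltrBrDl -subr_gt0; nra.
nra.
Unshelve. all: by end_near.
Qed.
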